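(* If SETH fails (i.e. $s_\infty<1$), then there is an $\varepsilon>0$ such that, for all constants $c$ and $d$, the satisfiability of depth-$d$ threshold circuits with $n$ inputs and at most $cn$ wires can be determined in time $O^*\big((2-\varepsilon)^n\big)$.
   Context: For an integer $d$, $d$-SAT is the satisfiability problem for CNF formulas with at most $d$ literals per clause on $n$ variables; $s_d$ is the infimum of all $\delta>0$ such that $d$-SAT can be solved in time $O(2^{\delta n})$, and $s_\infty=\lim_{d\to\infty}s_d$. SETH is the hypothesis $s_\infty=1$. A threshold circuit is a directed acyclic graph whose in-degree-$0$ vertices are input gates (there are $n$ of them) and whose other vertices are gates labeled by NEG (fan-in 1), AND, OR, or $\mathrm{TH}_\theta$ (unbounded fan-in; $\mathrm{TH}_\theta$ outputs $1$ iff at least $\theta$ of its inputs are $1$), with exactly one output gate; edges are wires, and the depth is the length of the longest directed path. The circuit is satisfiable if some $0/1$ setting of the input gates makes the output gate evaluate to $1$. $O^*(\cdot)$ suppresses factors polynomial in the input size. *)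

(* Defs.v *)
From HB Require Import structures.
From mathcomp Require Import all_boot all_order all_algebra.
From mathcomp Require Import all_classical all_reals all_analysis.

Set Implicit Arguments.
Unset Strict Implicit.
Unset Printing Implicit Defensive.

Import Order.TTheory GRing.Theory Num.Theory.

Local Open Scope nat_scope.

(* Model of computation: a deterministic random access machine under the
   logarithmic cost criterion (Cook-Reckhow).  A program is structured code over
   finitely many registers and finitely many arrays, all holding naturals and
   initially 0.  Every expression that is evaluated, in particular every address
   and every value read or written, is charged its bit length, so a running time
   here and the running time on a word RAM differ by a factor polynomial in the
   word length.  For running times 2^O(n) this is a factor polynomial in n,
   which changes neither the infimum [s_ R d] below nor an O^* bound. *)

Inductive binop := Add | Sub | Mul | Div | Equal | Less.

Inductive expr :=
  | Const of nat
  | Reg of nat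
  | Read of nat & expr            (* Read a e is the cell e of the array a *)
  | Bin of binop & expr & expr.

Inductive cmd :=
  | Skip
  | Assign of nat & expr          (* Assign x e : register x := e *)
  | Write of nat & expr & expr    (* Write a e1 e2 : cell e1 of array a := e2 *)
  | Seq of cmd & cmd
  | If of expr & cmd & cmd
  | While of expr & cmd.

Record state := State { regs : nat -> nat; arrays : nat -> nat -> nat }.

Definition bitlen (m : nat) : nat := (trunc_log 2 m).+1.

Definition binop_val (o : binop) (m1 m2 : nat) : nat :=
  match o with
  | Add => m1 + m2
  | Sub => m1 - m2
  | Mul => m1 * m2
  | Div => m1 %/ m2
  | Equal => m1 == m2
  | Less => m1 < m2
  end.

Fixpoint expr_val (s : state) (e : expr) : nat :=
  match e with
  | Const k => k
  | Reg x => regs s x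
  | Read a e1 => arrays s a (expr_val s e1)
  | Bin o e1 e2 => binop_val o (expr_val s e1) (expr_val s e2)
  end.

Fixpoint expr_cost (s : state) (e : expr) : nat :=
  bitlen (expr_val s e) +
  match e with
  | Const _ | Reg _ => 0
  | Read _ e1 => expr_cost s e1
  | Bin _ e1 e2 => expr_cost s e1 + expr_cost s e2
  end.

Definition set_reg (s : state) (x v : nat) : state :=
  State (fun y => if y == x then v else regs s y) (arrays s).

Definition set_cell (s : state) (a i v : nat) : state :=
  State (regs s)
    (fun b j => if (b == a) && (j == i) then v else arrays s b j).

(* exec p s t s' : started in s, the program p halts in s' after time t. *)
Inductive exec : cmd -> state -> nat -> state -> Prop :=
  | ExecSkip s : exec Skip s 1 s
  | ExecAssign s x e :
      exec (Assign x e) s (expr_cost s e) (set_reg s x (expr_val s e))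
  | ExecWrite s a e1 e2 :
      exec (Write a e1 e2) s (expr_cost s e1 + expr_cost s e2)
        (set_cell s a (expr_val s e1) (expr_val s e2))
  | ExecSeq p1 p2 s1 s2 s3 t1 t2 :
      exec p1 s1 t1 s2 -> exec p2 s2 t2 s3 -> exec (Seq p1 p2) s1 (t1 + t2) s3
  | ExecIf e p1 p2 s t s' :
      exec (if expr_val s e != 0 then p1 else p2) s t s' ->
      exec (If e p1 p2) s (expr_cost s e + t) s'
  | ExecWhileStop e p s :
      expr_val s e = 0 -> exec (While e p) s (expr_cost s e) s
  | ExecWhileStep e p s1 s2 s3 t1 t2 :
      expr_val s1 e != 0 -> exec p s1 t1 s2 -> exec (While e p) s2 t2 s3 ->
      exec (While e p) s1 (expr_cost s1 e + t1 + t2) s3.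

Lemma exec_det p s t1 s1 t2 s2 :
  exec p s t1 s1 -> exec p s t2 s2 -> t1 = t2 /\ s1 = s2.
Proof.
move=> ex1; elim: ex1 t2 s2 => {p s t1 s1}.
- by move=> s t2 s2 ex; inversion ex.
- by move=> s x e t2 s2 ex; inversion ex.
- by move=> s a e1 e2 t2 s2 ex; inversion ex.
- move=> p1 p2 s1 s2 s3 t1 t2 _ IH1 _ IH2 t s ex.
  inversion ex as [| | |? ? ? ? ? ? ? ex1 ex2| | |]; subst.
  have [? ?] := IH1 _ _ ex1; subst.
  by have [-> ->] := IH2 _ _ ex2.
- move=> e p1 p2 s t s' _ IH t2 s2 ex.
  inversion ex as [| | | |? ? ? ? ? ? ex1| |]; subst.
  by have [-> ->] := IH _ _ ex1.
- move=> e p s e0 t2 s2 ex.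
  inversion ex as [| | | | | |? ? ? ? ? ? ? en0]; subst => //.
  by rewrite e0 in en0.
- move=> e p s1 s2 s3 t1 t2 en0 _ IH1 _ IH2 t s ex.
  inversion ex as [| | | | |? ? ? e0|? ? ? ? ? ? ? ? ex1 ex2]; subst.
    by rewrite e0 in en0.
  have [? ?] := IH1 _ _ ex1; subst.
  by have [-> ->] := IH2 _ _ ex2.
Qed.

(* The input, a word over nat, is in array 0 and its length in register 0. *)
Definition init (w : seq nat) : state :=
  State (fun x => if x == 0 then size w else 0)
        (fun a i => if a == 0 then nth 0 w i else 0).

(* p accepts (b = true) or rejects (b = false) the input w in time t;
   the answer is whether register 0 is nonzero on halting. *)
Definition answers (p : cmd) (w : seq nat) (t : nat) (b : bool) : Prop :=
  exists2 s, exec p (init w) t s & b = (regs s 0 != 0).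

Definition bitsize (w : seq nat) : nat := \sum_(m <- w) bitlen m.

(* The literal (i, b) is x_i if b = true and its negation if b = false. *)
Definition literal (n : nat) : Type := ('I_n * bool)%type.
Definition cnf (n : nat) : Type := seq (seq (literal n)).

(* A formula is a set of clauses, whence [uniq]: its length is then polynomial
   in n for fixed d, and running times can be measured in n alone. *)
Definition dcnf (d n : nat) (F : cnf n) : bool :=
  uniq F && all (fun C => size C <= d) F.

Definition cnf_sat (n : nat) (F : cnf n) : bool :=
  [exists x : {ffun 'I_n -> bool}, all (has (fun l => x l.1 == l.2)) F].

Definition encode_literal (n : nat) (l : literal n) : nat := l.1.*2 + l.2.

Definition encode_clause (n : nat) (C : seq (literal n)) : seq nat :=
  size C :: map (@encode_literal n) C.

Definition encode_cnf (n : nat) (F : cnf n) : seq nat :=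
  n :: size F :: flatten (map (@encode_clause n) F).

Section Exponents.
Variable R : realType.
Local Open Scope ring_scope.
Local Open Scope classical_set_scope.
Local Open Scope ereal_scope.

Definition dsat_solvable (d : nat) (delta : R) : Prop :=
  exists (p : cmd) (K : R), forall (n : nat) (F : cnf n), dcnf d F ->
    exists2 t : nat, answers p (encode_cnf F) t (cnf_sat F)
                   & (t%:R <= K * 2 `^ (delta * n%:R))%R.

(* The infimum is taken in the extended reals, so that no value is assigned by
   convention to the infimum of an empty or unbounded set of reals. *)
Definition s_ (d : nat) : \bar R :=
  ereal_inf [set delta%:E | delta in
    [set delta : R | (0 < delta)%R /\ dsat_solvable d delta]].

Definition s_infty : \bar R := limn s_.

Lemma s_nondecreasing : {homo s_ : d e / (d <= e)%N >-> d <= e}.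
Proof.
move=> d e de; apply: ereal_inf_le_tmp => _ [delta [delta0 [p [K pK]]] <-].
exists delta => //; split=> //; exists p, K => n F /andP[uF dF].
apply: pK; rewrite /dcnf uF /=.
by apply: sub_all dF => C /leq_trans; apply.
Qed.

Lemma cvg_s_infty : s_ @ \oo --> s_infty.
Proof. exact/ereal_nondecreasing_is_cvgn/s_nondecreasing. Qed.

End Exponents.

Inductive gate := Input | NEG | AND | OR | TH of nat.

Definition is_input (g : gate) : bool := if g is Input then true else false.
Definition is_neg (g : gate) : bool := if g is NEG then true else false.

Record circuit := Circuit {
  nverts : nat;
  wire : rel 'I_nverts;
  label : 'I_nverts -> gate;
  output : 'I_nverts;
  circuit_acyclic : forall u v, wire u v -> ~~ connect wire v u;
  circuit_input : forall v, is_input (label v) = (#|[set u | wire u v]| == 0);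
  circuit_neg : forall v, is_neg (label v) -> #|[set u | wire u v]| = 1
}.

Section Circuit.
Variable C : circuit.
Implicit Types (u v : 'I_(nverts C)) (x : {set 'I_(nverts C)}).

Definition preds v : {set 'I_(nverts C)} := [set u | wire u v].

Definition inputs : {set 'I_(nverts C)} := [set v | is_input (label v)].

Definition wires : nat := #|[set uv : 'I_(nverts C) * 'I_(nverts C) | wire uv.1 uv.2]|.

(* [k] bounds the length of the directed paths of the circuit: an acyclic
   circuit has no path with as many wires as there are vertices. *)
Definition depth : nat :=
  \max_(k < nverts C | [exists u, exists p : k.-tuple 'I_(nverts C),
                         path (@wire C) u p]) k.

(* m of the k wires entering a gate g carry the value 1. *)
Definition gate_val (g : gate) (m k : nat) : bool :=
  match g with
  | Input => false
  | NEG => m == 0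
  | AND => m == k
  | OR => 0 < m
  | TH theta => theta <= m
  end.

(* A 0/1 setting is represented by the set x of the input gates set to 1. The
   number k is recursion fuel; [evalE] shows that it does not run out. *)
Fixpoint eval_fuel (k : nat) x v : bool :=
  if is_input (label v) then v \in x else
  if k is k'.+1 then
    gate_val (label v) #|[set u in preds v | eval_fuel k' x u]| #|preds v|
  else false.

Definition eval x v : bool := eval_fuel (nverts C) x v.

Definition circuit_sat : bool :=
  [exists x : {set 'I_(nverts C)}, (x \subset inputs) && eval x (output C)].

Lemma circuit_path_uniq u p : path (@wire C) u p -> uniq (u :: p).
Proof.
elim: p u => //= v p IHp u /andP[uv vp]; rewrite (IHp _ vp) andbT.
apply: contra (circuit_acyclic uv) => u_vp.
case/splitPl: u_vp vp => p1 p2 lp; rewrite cat_path => /andP[vp1 _].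
by apply/connectP; exists p1.
Qed.

Lemma path_size_lt u p : path (@wire C) u p -> size p < nverts C.
Proof.
move/circuit_path_uniq/card_uniqP => /= <-.
by rewrite -[X in _ <= X]card_ord max_card.
Qed.

Lemma path_size_depth u p : path (@wire C) u p -> size p <= depth.
Proof.
move=> /[dup] up /path_size_lt lt_p.
apply: (leq_trans _ (leq_bigmax_cond (Ordinal lt_p) _)) => //=.
by apply/existsP; exists u; apply/existsP; exists (in_tuple p).
Qed.

Lemma depth_path : exists u p, path (@wire C) u p /\ size p = depth.
Proof.
have order0 : 0 < nverts C by apply: leq_ltn_trans (ltn_ord (output C)).
rewrite /depth (bigop.bigmax_eq_arg (Ordinal order0)); last first.
  by apply/existsP; exists (output C); apply/existsP; exists [tuple].
case: arg_maxnP => /=.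
  by apply/existsP; exists (output C); apply/existsP; exists [tuple].
move=> k /existsP[u /existsP[p up]] _.
by exists u, p; rewrite size_tuple.
Qed.

Lemma evalE x v :
  eval x v = if is_input (label v) then v \in x else
             gate_val (label v) #|[set u in preds v | eval x u]| #|preds v|.
Proof.
have fuel k l w :
    (forall q u, path (@wire C) u q -> last u q = w -> size q <= k) ->
    (forall q u, path (@wire C) u q -> last u q = w -> size q <= l) ->
    eval_fuel k x w = eval_fuel l x w.
  elim: k l w => [|k IHk] [|l] w wk wl //=.
  - case: ifPn => // nin; rewrite circuit_input in nin.
    have /set0Pn[u] : [set u | wire u w] != finset.set0 by rewrite -cards_eq0.
    by rewrite inE => uw; have := wk [:: w] u; rewrite /= uw => /(_ isT erefl).
  - case: ifPn => // nin; rewrite circuit_input in nin.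
    have /set0Pn[u] : [set u | wire u w] != finset.set0 by rewrite -cards_eq0.
    by rewrite inE => uw; have := wl [:: w] u; rewrite /= uw => /(_ isT erefl).
  case: ifPn => // _; congr (gate_val _ _ _); apply: eq_card => u.
  rewrite !inE; case: (boolP (wire u w)) => //= uw.
  apply: IHk => q u' u'q lq.
    by have := wk (rcons q w) u'; rewrite rcons_path u'q lq uw last_rcons size_rcons; apply.
  by have := wl (rcons q w) u'; rewrite rcons_path u'q lq uw last_rcons size_rcons; apply.
rewrite /eval (fuel (nverts C) (nverts C).+1 v) //=.
- by move=> q u uq _; apply/ltnW/(path_size_lt uq).
- by move=> q u uq _; apply/ltnW/ltnW/(path_size_lt uq).
Qed.

Definition gate_code (g : gate) : nat :=
  match g with Input => 0 | NEG => 1 | AND => 2 | OR => 3 | TH _ => 4 end.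

Definition threshold (g : gate) : nat := if g is TH theta then theta else 0.

Definition encode_gate v : seq nat :=
  [:: gate_code (label v), threshold (label v), #|preds v|
    & map (@nat_of_ord (nverts C)) (enum (preds v))].

(* The vertices are listed in an arbitrary order, not necessarily a
   topological one. *)
Definition encode_circuit : seq nat :=
  nverts C :: nat_of_ord (output C)
    :: flatten (map encode_gate (enum 'I_(nverts C))).

End Circuit.

(* Main.v *)
(* Fix a large constant K.  Call a gate big if its fan-in exceeds K, and cut its
   incoming wires into blocks of K.  A circuit with c n wires has at most
   2 c n / K blocks, so there are only 2^(e n) ways to guess the number of true
   wires in every block, with e -> 0 as K -> oo.  A guess fixes the value of
   every big gate; in depth d, every block and the output then depend on at
   most K^(d+1) inputs, so that "the guess is right and the output is true" is a
   k-CNF with k = K^(d+1).  Its clauses are found by running through all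
   k-tuples of literals and evaluating the circuit in three-valued logic on the
   partial assignment that falsifies the tuple.  The circuit is satisfiable iff
   one of these 2^(e n) formulas is, and a solver for k-SAT with exponent
   delta < 1, run on each of them, gives the exponent delta + e.

   On the machine, the solver is run for the j-th of M guesses with cell i
   replaced by cell i M + j, so every run starts on memory that is still 0. *)
Require Import Defs.
From HB Require Import structures.
From mathcomp Require Import all_boot all_order all_algebra.
From mathcomp Require Import all_classical all_reals all_analysis.
From mathcomp Require Import zify ring lra.
Import Order.TTheory GRing.Theory Num.Theory.
Set Implicit Arguments.
Unset Strict Implicit.
Unset Printing Implicit Defensive.
Local Open Scope nat_scope.

(** * Bounded loop programs *)

(** The gain [eps] must be fixed before [c] and [d]. It depends only on a [delta] strictly between
    [s_infty] and 1: every clause width has a solver with this same [delta], so [c] enters only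
    through [K], and [d] only through the width. Two obstacles come from the machine. The solver is
    an arbitrary program, so there is no telling which cells to clear between runs; and a program
    names finitely many arrays while [M] grows with [n], hence the interleaving of cells modulo [M].
    Moreover costs are logarithmic, so bit lengths have to be controlled along with step counts. The
    reduction is therefore written in a loop language in which every loop is cut off at a cap and
    the values kept in its own memory grow additively in bit length. One theorem, [exec_compile],
    bounds the time of all such programs, and what remains is reasoning about the function [den]. *)

Lemma bitlen_gt0 m : 0 < bitlen m. Proof. by []. Qed.

Lemma bitlenS m1 m2 : m1 <= m2 -> bitlen m1 <= bitlen m2.
Proof. by move=> h; rewrite /bitlen ltnS; apply: leq_trunc_log. Qed.

Lemma ltn_bitlen m : m < 2 ^ bitlen m.
Proof. exact: trunc_log_ltn. Qed.

Lemma bitlen_le m l : 0 < l -> m < 2 ^ l -> bitlen m <= l.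
Proof.
case: m => [|m] l0 h; first by rewrite /bitlen trunc_log0.
by rewrite /bitlen -(ltn_exp2l _ _ (ltnSn 1)) (leq_ltn_trans _ h) // trunc_logP.
Qed.

Lemma bitlenD m1 m2 : bitlen (m1 + m2) <= (maxn (bitlen m1) (bitlen m2)).+1.
Proof.
apply: bitlen_le => //; rewrite expnS mul2n -addnn.
have h1 := ltn_bitlen m1; have h2 := ltn_bitlen m2.
have h3 : 2 ^ bitlen m1 <= 2 ^ maxn (bitlen m1) (bitlen m2) by rewrite leq_pexp2l ?leq_maxl.
have h4 : 2 ^ bitlen m2 <= 2 ^ maxn (bitlen m1) (bitlen m2) by rewrite leq_pexp2l ?leq_maxr.
lia.
Qed.

Lemma bitlenM m1 m2 : bitlen (m1 * m2) <= bitlen m1 + bitlen m2.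
Proof.
by apply: bitlen_le; rewrite ?addn_gt0 // expnD ltn_mul ?ltn_bitlen.
Qed.

Lemma bitlen_bool (b : bool) : bitlen b = 1. Proof. by case: b. Qed.

Lemma bitlen_leq m : bitlen m <= m.+1.
Proof. by apply: bitlen_le => //; rewrite (leq_trans (ltn_expl m (ltnSn 1))) // leq_exp2l. Qed.

(* The arrays from [arr0] on are the memory of the simulated SAT solver; our
   own code writes to them but never reads them. *)
Notation arr0 := 7.
Notation capreg := 1.

(** A constant counts with its bit length, so that an expression over data of at most [L] bits has a
    value of at most [esize e * L] bits, products included. *)
Fixpoint esize (e : expr) : nat :=
  match e with
  | Const k => bitlen k
  | Reg _ => 1
  | Read _ e1 => (esize e1).+1
  | Bin _ e1 e2 => (esize e1 + esize e2).+1
  end.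

Fixpoint own (e : expr) : bool :=
  match e with
  | Const _ | Reg _ => true
  | Read a e1 => (a < arr0) && own e1
  | Bin _ e1 e2 => own e1 && own e2
  end.

(* Only such values are stored in our own memory: they have at most esize e more
   bits than the values they are computed from, so that bit lengths stay
   polynomial over polynomially many steps. *)
Fixpoint additive_expr (e : expr) : bool :=
  match e with
  | Const _ | Reg _ | Read _ _ => true
  | Bin Add e1 e2 => additive_expr e1 && additive_expr e2
  | Bin Mul e1 (Const _) => additive_expr e1
  | Bin Mul _ _ => false
  | Bin Defs.Sub e1 _ | Bin Div e1 _ => additive_expr e1
  | Bin Equal _ _ | Bin Less _ _ => true
  end.

(** The simulated solver keeps all its data, registers included, in arrays from [arr0] on, where bit
    lengths are not under control. *)
Definition bounded (L : nat) (s : state) : Prop :=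
  (forall x, bitlen (regs s x) <= L) /\
  (forall a i, a < arr0 -> bitlen (arrays s a i) <= L).

Lemma bounded_gt0 L s : bounded L s -> 0 < L.
Proof. by case=> h _; apply: leq_trans (h 0). Qed.

Lemma boundedW L1 L2 s : L1 <= L2 -> bounded L1 s -> bounded L2 s.
Proof.
by move=> h [h1 h2]; split=> *; apply: leq_trans h; [apply: h1|apply: h2].
Qed.

Lemma esize_gt0 e : 0 < esize e. Proof. by case: e. Qed.

Lemma bitlen_val L s e : bounded L s -> own e ->
  bitlen (expr_val s e) <= esize e * L.
Proof.
move=> bs; have L0 := bounded_gt0 bs; case: (bs) => hr ha.
elim: e => [k|x|a e1 IH|o e1 IH1 e2 IH2] /=.
- by move=> _; rewrite leq_pmulr.
- by rewrite mul1n.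
- by case/andP=> aa _; rewrite mulSn (leq_trans (ha _ _ aa)) // leq_addr.
case/andP=> /IH1 {}IH1 /IH2 {}IH2; rewrite mulSn mulnDl.
case: o => /=.
- have := bitlenD (expr_val s e1) (expr_val s e2); lia.
- have := bitlenS (leq_subr (expr_val s e2) (expr_val s e1)); lia.
- have := bitlenM (expr_val s e1) (expr_val s e2); lia.
- have := bitlenS (leq_div (expr_val s e1) (expr_val s e2)); lia.
- rewrite bitlen_bool; lia.
- rewrite bitlen_bool; lia.
Qed.

Lemma bitlen_additive L s e : bounded L s -> own e -> additive_expr e ->
  bitlen (expr_val s e) <= L + esize e.
Proof.
move=> [hr ha]; elim: e => [k|x|a e1 IH|o e1 IH1 e2 IH2] /=.
- by move=> _ _; rewrite leq_addl.
- by move=> _ _; rewrite (leq_trans (hr x)) // leq_addr.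
- by case/andP=> aa _ _; rewrite (leq_trans (ha _ _ aa)) // leq_addr.
case/andP=> /IH1 {}IH1 /IH2 {}IH2.
case: o => //=.
- case/andP=> /IH1 {}IH1 /IH2 {}IH2.
  have := bitlenD (expr_val s e1) (expr_val s e2).
  have := esize_gt0 e1; have := esize_gt0 e2; lia.
- move/IH1; have := bitlenS (leq_subr (expr_val s e2) (expr_val s e1)); lia.
- case: e2 IH2 => //= k _ /IH1; have := bitlenM (expr_val s e1) k; lia.
- move/IH1; have := bitlenS (leq_div (expr_val s e1) (expr_val s e2)); lia.
- rewrite bitlen_bool; lia.
- rewrite bitlen_bool; lia.
Qed.

(** The square arises because an expression has at most [esize e] subexpressions, each with a value
    of at most [esize e * L] bits. *)
Lemma expr_cost_le L s e : bounded L s -> own e ->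
  expr_cost s e <= esize e * esize e * L.
Proof.
move=> bs; elim: e => [k|x|a e1 IH|o e1 IH1 e2 IH2] /=.
- move=> _; rewrite addn0 -mulnA leq_pmulr // muln_gt0 /=; exact: bounded_gt0 bs.
- by move=> _; rewrite addn0 !mul1n; case: bs.
- move=> h; have := bitlen_val bs (h : own (Read a e1)) => /=.
  case/andP: h => _ /IH; nia.
- move=> h; have := bitlen_val bs (h : own (Bin o e1 e2)) => /=.
  case/andP: h => /IH1 {}IH1 /IH2 {}IH2; nia.
Qed.

Inductive prog :=
  | PSkip
  | PSet of nat & expr
  | PWrite of nat & expr & expr
  | PSeq of prog & prog
  | PIf of expr & prog & prog
  (* PFor x y e b runs b for x = 0, ..., min(e, cap) - 1, where y holds the bound;
     the cap gives a bound on the running time that does not depend on the state *)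
  | PFor of nat & nat & expr & prog.

Definition set2 (s : state) x y m := set_reg (set_reg s y m) x 0.

(** Truncated subtraction makes this the minimum of the value of [e] and the cap. *)
Definition forbound (s : state) (e : expr) : nat :=
  expr_val s e - (expr_val s e - regs s capreg).

(** The loop case sets [x] to [i.+1] outright, where [compile] increments it; the two agree because
    [wf] forbids the body to set [x] or [y]. *)
Fixpoint den (p : prog) (s : state) : state :=
  match p with
  | PSkip => s
  | PSet x e => set_reg s x (expr_val s e)
  | PWrite a e1 e2 => set_cell s a (expr_val s e1) (expr_val s e2)
  | PSeq p1 p2 => den p2 (den p1 s)
  | PIf e p1 p2 => if expr_val s e != 0 then den p1 s else den p2 s
  | PFor x y e b =>
      let m := forbound s e in
      iteri m (fun i s' => set_reg (den b s') x i.+1) (set2 s x y m)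
  end.

Fixpoint compile (p : prog) : cmd :=
  match p with
  | PSkip => Skip
  | PSet x e => Assign x e
  | PWrite a e1 e2 => Write a e1 e2
  | PSeq p1 p2 => Seq (compile p1) (compile p2)
  | PIf e p1 p2 => If e (compile p1) (compile p2)
  | PFor x y e b =>
      Seq (Assign y (Bin Defs.Sub e (Bin Defs.Sub e (Reg capreg))))
        (Seq (Assign x (Const 0))
          (While (Bin Less (Reg x) (Reg y))
            (Seq (compile b) (Assign x (Bin Add (Reg x) (Const 1))))))
  end.

Fixpoint setsreg (p : prog) (z : nat) : bool :=
  match p with
  | PSkip | PWrite _ _ _ => false
  | PSet x _ => z == x
  | PSeq p1 p2 | PIf _ p1 p2 => setsreg p1 z || setsreg p2 z
  | PFor x y _ b => [|| z == x, z == y | setsreg b z]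
  end.

Fixpoint setsarr (p : prog) (a : nat) : bool :=
  match p with
  | PSkip | PSet _ _ => false
  | PWrite b _ _ => a == b
  | PSeq p1 p2 | PIf _ p1 p2 => setsarr p1 a || setsarr p2 a
  | PFor _ _ _ b => setsarr b a
  end.

(** A well-formed program never assigns the cap, so a bound [c] on it stays valid throughout. Writes
    to the solver's arrays are exempt from additivity, since own code does not read them back. *)
Fixpoint wf (p : prog) : bool :=
  match p with
  | PSkip => true
  | PSet x e => [&& own e, additive_expr e & x != capreg]
  | PWrite a e1 e2 => [&& own e1, own e2 & (arr0 <= a) || additive_expr e2]
  | PSeq p1 p2 => wf p1 && wf p2
  | PIf e p1 p2 => [&& own e, wf p1 & wf p2]
  | PFor x y e b =>
      [&& own e, additive_expr e, wf b, ~~ setsreg b x, ~~ setsreg b y, x != y,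
          x != capreg & y != capreg]
  end.

(** One number bounds both the time factor and the added bits. This makes [W * (L + W)] stable under
    sequencing: [W1 * (L + W1) + W2 * (L + W1 + W2)] is at most [W * (L + W)] for [W = W1 + W2]. In
    a loop, [f] pays for computing the bound; of the 20 per round, 18 pay for guard and increment,
    each of size 3 and so of cost at most 9 times the bit bound. *)
Fixpoint weight (p : prog) (c : nat) : nat :=
  match p with
  | PSkip => 1
  | PSet _ e => esize e * esize e
  | PWrite _ e1 e2 => esize e1 * esize e1 + esize e2 * esize e2
  | PSeq p1 p2 => weight p1 c + weight p2 c
  | PIf e p1 p2 => esize e * esize e + weight p1 c + weight p2 c
  | PFor _ _ e b =>
      let f := (esize e + esize e + 3) * (esize e + esize e + 3) in
      f + 10 + c.+1 * (20 + weight b c)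
  end.

Lemma iteri_ind T (I : nat -> T -> Prop) m f (z : T) :
  I 0 z -> (forall i t, i < m -> I i t -> I i.+1 (f i t)) -> I m (iteri m f z).
Proof.
move=> I0 IS; elim: m IS => //= m IH IS.
by apply: (IS) => //; apply: IH => i t /ltnW im; apply: IS.
Qed.

Lemma den_regs p s z : ~~ setsreg p z -> regs (den p s) z = regs s z.
Proof.
elim: p s => [|x e|a e1 e2|p1 IH1 p2 IH2|e p1 IH1 p2 IH2|x y e b IH] s //=.
- by move/negbTE=> ->.
- by rewrite negb_or => /andP[? ?]; rewrite IH2 ?IH1.
- by rewrite negb_or => /andP[? ?]; case: ifP => _; [apply: IH1|apply: IH2].
rewrite !negb_or => /and3P[/negbTE zx /negbTE zy nb].
apply: (@iteri_ind _ (fun _ t => regs t z = regs s z)) => [|i t _ h] /=; rewrite zx ?zy //.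
by rewrite IH.
Qed.

Lemma den_arrays p s a : ~~ setsarr p a -> arrays (den p s) a = arrays s a.
Proof.
elim: p s => [|x e|b e1 e2|p1 IH1 p2 IH2|e p1 IH1 p2 IH2|x y e b IH] s //=.
- by move/negbTE=> ->.
- by rewrite negb_or => /andP[? ?]; rewrite IH2 ?IH1.
- by rewrite negb_or => /andP[? ?]; case: ifP => _; [apply: IH1|apply: IH2].
move=> nb.
by apply: (@iteri_ind _ (fun _ t => arrays t a = arrays s a)) => // i t _ h /=; rewrite IH.
Qed.

Lemma wf_cap p : wf p -> ~~ setsreg p capreg.
Proof.
elim: p => [|x e|b e1 e2|p1 IH1 p2 IH2|e p1 IH1 p2 IH2|x y e b IH] //=.
- by case/and3P=> _ _; rewrite eq_sym.
- by case/andP=> /IH1 h1 /IH2 h2; rewrite negb_or h1.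
- by case/and3P=> _ /IH1 h1 /IH2 h2; rewrite negb_or h1.
- by rewrite !negb_or ![capreg == _]eq_sym => /and5P[_ _ /IH-> _ /and4P[_ _ -> ->]].
Qed.

Lemma bounded_set L L' s x v : bounded L s -> L <= L' -> bitlen v <= L' ->
  bounded L' (set_reg s x v).
Proof.
move=> [h1 h2] LL vL; split=> [y|a i aa] /=.
  by case: ifP => _ //; apply: leq_trans LL.
by apply: leq_trans LL; apply: h2.
Qed.

Arguments bounded_set {L L' s x v}.

Lemma exec_compile c p : wf p -> forall L s, bounded L s -> regs s capreg <= c ->
  exists t, [/\ exec (compile p) s t (den p s),
    t <= weight p c * (L + weight p c) & bounded (L + weight p c) (den p s)].
Proof.
elim: p => [|x e|a e1 e2|p1 IH1 p2 IH2|e p1 IH1 p2 IH2|x y e b IH] /= wfp L s bs sc.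
- exists 1; split; [exact: ExecSkip|by rewrite mul1n addn1|].
  by apply: boundedW bs; rewrite leq_addr.
- case/and3P: wfp => oe ae _; exists (expr_cost s e); split; first exact: ExecAssign.
    by apply: leq_trans (expr_cost_le bs oe) _; rewrite leq_mul // leq_addr.
    apply: (bounded_set bs); first by rewrite leq_addr.
  apply: leq_trans (bitlen_additive bs oe ae) _.
  by rewrite leq_add2l leq_pmulr ?esize_gt0.
- case/and3P: wfp => oe1 oe2 ae; exists (expr_cost s e1 + expr_cost s e2).
  split; first exact: ExecWrite.
    have := expr_cost_le bs oe1; have := expr_cost_le bs oe2; nia.
  case: (bs) => h1 h2; split=> [z|a' i aa] /=.
    by apply: leq_trans (h1 z) _; rewrite leq_addr.
  case: ifP => [/andP[/eqP aE _]|_]; last by apply: leq_trans (h2 _ _ aa) _; rewrite leq_addr.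
  case/orP: ae => [|ae]; first by rewrite -aE leqNgt aa.
  apply: leq_trans (bitlen_additive bs oe2 ae) _.
  by rewrite leq_add2l (leq_trans (leq_pmulr _ (esize_gt0 e2))) // leq_addl.
- case/andP: wfp => wf1 wf2.
  have [t1 [ex1 c1 b1]] := IH1 wf1 _ _ bs sc.
  have sc1 : regs (den p1 s) capreg <= c by rewrite den_regs ?wf_cap.
  have [t2 [ex2 c2 b2]] := IH2 wf2 _ _ b1 sc1.
  exists (t1 + t2); split; first exact: ExecSeq ex1 ex2.
    nia.
  by rewrite addnA.
- case/and3P: wfp => oe wf1 wf2; have ec := expr_cost_le bs oe.
  have : exists t, [/\ exec (if expr_val s e != 0 then compile p1 else compile p2) s t
      (if expr_val s e != 0 then den p1 s else den p2 s),
    t <= (weight p1 c + weight p2 c) * (L + (weight p1 c + weight p2 c)) &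
    bounded (L + (weight p1 c + weight p2 c)) (if expr_val s e != 0 then den p1 s else den p2 s)].
    case: ifP => _.
      have [t [ex1 c1 b1]] := IH1 wf1 _ _ bs sc.
      exists t; split => //; first by nia.
      by apply: boundedW b1; lia.
    have [t [ex1 c1 b1]] := IH2 wf2 _ _ bs sc.
    exists t; split => //; first by nia.
    by apply: boundedW b1; lia.
  case=> t [ex1 c1 b1]; exists (expr_cost s e + t); split.
  - exact: ExecIf.
  - rewrite -addnA; nia.
  - by apply: boundedW b1; lia.
case/and5P: wfp => oe ae wfb nbx /and4P[nby xy xc yc].
set m := forbound s e.
set E := Bin Defs.Sub e (Bin Defs.Sub e (Reg capreg)).
have oE : own E by rewrite /= oe.
have aE : additive_expr E by [].
have ecE := expr_cost_le bs oE.
have bE := bitlen_additive bs oE aE.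
have mE : expr_val s E = m by [].
have mc : m <= c by rewrite /m /forbound; lia.
set L1 := L + esize E.
have b1 : bounded L1 (set_reg s y m) by apply: (bounded_set bs) => //; rewrite /L1 ?leq_addr.
have b2 : bounded L1 (set2 s x y m).
  by apply: (bounded_set b1) => //; rewrite /bitlen trunc_log0; case: b1 => h _; apply: leq_trans (h 0).
have L10 := bounded_gt0 b2.
set F := fun i s' => set_reg (den b s') x i.+1.
set W := weight b c.
pose st i := iteri i F (set2 s x y m).
have stS i : st i.+1 = set_reg (den b (st i)) x i.+1 by [].
have st0 : st 0 = set2 s x y m by [].
have -> : iteri m F (set2 s x y m) = st m by [].
clearbody st.
have stx i : regs (st i) x = i by case: i => [|i]; rewrite ?st0 ?stS /= eqxx.
have sty i : regs (st i) y = m.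
  elim: i => [|i IHi]; rewrite ?st0 ?stS /= eq_sym (negbTE xy) ?eqxx //.
  by rewrite den_regs.
have stc i : regs (st i) capreg <= c.
  elim: i => [|i IHi]; rewrite ?st0 ?stS /= ![capreg == _]eq_sym (negbTE xc) ?(negbTE yc) //.
  by rewrite den_regs ?wf_cap.
(* A round adds at most [W] bits through its body; the extra 2 leaves room for the incremented
   counter. *)
have bst i : bounded (L1 + i * (W + 2)) (st i).
  elim: i => [|i IHi]; first by rewrite st0 mul0n addn0.
  have [t [_ _ bb]] := IH wfb _ _ IHi (stc i).
  have Hi : bitlen i <= L1 + i * (W + 2) by rewrite -[X in bitlen X](stx i); case: IHi.
  rewrite stS; apply: (bounded_set bb); first by rewrite mulSn -/W; lia.
  have := bitlenD i 1; rewrite addn1 mulSn (bitlen_bool true); move: Hi; lia.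
set G := Bin Less (Reg x) (Reg y).
set N := Bin Add (Reg x) (Const 1).
set body := Seq (compile b) (Assign x N).
set LM := L1 + c * (W + 2).
have bstM i : i <= m -> bounded LM (st i).
  by move=> im; apply: boundedW (bst i); rewrite /LM leq_add2l leq_mul2r (leq_trans im mc) orbT.
have costG i : i <= m -> expr_cost (st i) G <= 9 * LM.
  by move=> im; apply: leq_trans (expr_cost_le (bstM i im) (isT : own G)) _.
(* The induction is on the number of rounds left, which is how [ExecWhileStep] unfolds. *)
have whl j : j <= m -> exists2 t, exec (While G body) (st (m - j)) t (st m) &
   t <= 9 * LM + j * (18 * LM + W * (LM + W)).
  elim: j => [|j IHj] jm.
    rewrite subn0; exists (expr_cost (st m) G); last by rewrite addn0 costG.
    by apply: ExecWhileStop; rewrite /= stx sty ltnn.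
  have [t ex ct] := IHj (ltnW jm).
  have im : m - j.+1 < m by lia.
  set i := m - j.+1 in im *.
  have [tb [exb cb bb]] := IH wfb _ _ (bstM i (ltnW im)) (stc i).
  have b3 : bounded (LM + W) (den b (st i)) by [].
  exists (expr_cost (st i) G + (tb + expr_cost (den b (st i)) N) + t).
    apply: ExecWhileStep.
    - by rewrite /= stx sty im.
    - apply: ExecSeq exb _; exact: ExecAssign.
    - have -> : set_reg (den b (st i)) x (expr_val (den b (st i)) N) = st (m - j).
        rewrite (_ : m - j = i.+1); last by rewrite /i; lia.
        by rewrite stS /= den_regs // stx addn1.
      exact: ex.
  have cG := costG i (ltnW im).
  have cN : expr_cost (den b (st i)) N <= 9 * LM.
    rewrite /= den_regs // stx.
    have: bitlen (i + 1) <= LM.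
      by rewrite addn1 -[in bitlen _](stx i.+1); case: (bstM i.+1 im).
    have: bitlen i <= LM by rewrite -[in bitlen _](stx i); case: (bstM i (ltnW im)).
    have := bitlen_bool true; rewrite /=. have : 0 < LM by rewrite /LM; lia.
    lia.
  rewrite mulSn -/W in cb *; lia.
have [tw exw cw] := whl m (leqnn m).
rewrite subnn st0 in exw.
exists (expr_cost s E + (expr_cost (set_reg s y m) (Const 0) + tw)); split.
- apply: ExecSeq; first exact: ExecAssign.
  apply: ExecSeq; first exact: ExecAssign.
  exact: exw.
- have -> : expr_cost (set_reg s y m) (Const 0) = bitlen 0 + 0 by [].
  set e2 := esize e + esize e + 3; set f := e2 * e2.
  have eE : esize E = e2 by rewrite /= /e2; lia.
  rewrite (bitlen_bool false) addn0.
  rewrite eE -/f in ecE.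
  have e2f : e2 <= f by rewrite /f leq_pmulr // /e2; lia.
  set R := c.+1 * (20 + W); set X := L + (f + 10 + R).
  have PR : c * (W + 2) + W + 2 <= R.
    rewrite /R mulSn [W + 2]addnC. have : c * (2 + W) <= c * (20 + W) by rewrite leq_mul2l leq_add2r orbT.
    clear; lia.
  have LMW : LM + W + 1 <= X by rewrite /LM /L1 eE /X; clear -e2f PR; lia.
  have h1 : 18 * LM + W * (LM + W) <= (18 + W) * X.
    by rewrite mulnDl leq_add // leq_mul2l; clear -LMW; lia.
  have h2 : m * (18 * LM + W * (LM + W)) <= c * ((20 + W) * X).
    by rewrite leq_mul // (leq_trans h1) // leq_mul2r leq_add2r orbT.
  have h3 : f * L <= f * X by rewrite leq_mul2l /X leq_addr orbT.
  have -> : (f + 10 + R) * X = f * X + 10 * X + (20 + W) * X + c * ((20 + W) * X).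
    by clearbody f; rewrite mulnDl [(f + 10) * X]mulnDl {1}/R mulSn [(20 + W + _) * X]mulnDl -mulnA addnA.
  have h4 : 20 * X <= (20 + W) * X by rewrite leq_mul2r leq_addr orbT.
  move: (leq_trans ecE h3) (leq_trans cw (leq_add (leqnn _) h2)) h4 LMW; clear.
  move: (c * ((20 + W) * X)) => u2; move: ((20 + W) * X) => u3; move: (f * X) => u1.
  move: (expr_cost s E) => u4. lia.
- apply: boundedW (bstM m (leqnn m)).
  set e2 := esize e + esize e + 3; set f := e2 * e2.
  have eE : esize E = e2 by rewrite /= /e2; lia.
  have e2f : e2 <= f by rewrite /f leq_pmulr // /e2; lia.
  set R := c.+1 * (20 + W).
  have PR : c * (W + 2) + W + 2 <= R.
    rewrite /R mulSn [W + 2]addnC. have : c * (2 + W) <= c * (20 + W) by rewrite leq_mul2l leq_add2r orbT.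
    clear; lia.
  by rewrite /LM /L1 eE; clear -e2f PR; lia.
Qed.

(** The base [c.+2] is at least 2 even for [c = 0], so raising the exponent never lowers the
    bound. *)
Definition polyb (f : nat -> nat) : Prop :=
  exists A D, forall c, f c <= A * c.+2 ^ D.

Lemma polyb_const a : polyb (fun=> a).
Proof. by exists a, 0 => c; rewrite expn0 muln1. Qed.

Lemma polyb_id : polyb id.
Proof. by exists 1, 1 => c; rewrite expn1 mul1n; lia. Qed.

Lemma polybM f g : polyb f -> polyb g -> polyb (fun c => f c * g c).
Proof.
move=> [A [D h]] [A' [D' h']]; exists (A * A'), (D + D') => c.
by rewrite expnD mulnACA leq_mul.
Qed.

Lemma polybD f g : polyb f -> polyb g -> polyb (fun c => f c + g c).
Proof.
move=> [A [D h]] [A' [D' h']]; exists (A + A'), (D + D') => c.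
rewrite mulnDl leq_add //.
  by rewrite (leq_trans (h c)) // leq_mul2l leq_pexp2l ?orbT ?leq_addr.
by rewrite (leq_trans (h' c)) // leq_mul2l leq_pexp2l ?orbT ?leq_addl.
Qed.

Lemma polyb_comp f g : polyb f -> polyb g -> polyb (fun c => f (g c)).
Proof.
move=> [A [D h]] [A' [D' h']]; exists (A * (A' + 2) ^ D), (D' * D) => c.
rewrite (leq_trans (h _)) // -mulnA leq_mul2l expnM -expnMn.
have hc : (g c).+2 <= (A' + 2) * c.+2 ^ D'.
  have := h' c; have : 0 < c.+2 ^ D' by rewrite expn_gt0.
  by rewrite mulnDl; move: (c.+2 ^ D') => u; lia.
by case: D {h} => [|D]; rewrite ?expn0 ?orbT // leq_exp2r // hc orbT.
Qed.

Lemma polyb_weight p : polyb (weight p).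
Proof.
elim: p => [|x e|a e1 e2|p1 IH1 p2 IH2|e p1 IH1 p2 IH2|x y e b IH] /=;
  try exact: polyb_const.
- exact: polybD.
- by apply: polybD => //; apply: polybD => //; apply: polyb_const.
- apply: polybD; first exact: polyb_const.
  apply: polybM; last by apply: polybD => //; apply: polyb_const.
  by exists 1, 1 => c; rewrite mul1n expn1.
Qed.

(** * Reasoning rules for loop programs *)

Lemma den_seq p q s : den (PSeq p q) s = den q (den p s). Proof. by []. Qed.
Lemma den_set x e s : den (PSet x e) s = set_reg s x (expr_val s e). Proof. by []. Qed.
Lemma den_write a e1 e2 s :
  den (PWrite a e1 e2) s = set_cell s a (expr_val s e1) (expr_val s e2).
Proof. by []. Qed.
Lemma den_if e p q s :
  den (PIf e p q) s = if expr_val s e != 0 then den p s else den q s.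
Proof. by []. Qed.
Lemma den_skip s : den PSkip s = s. Proof. by []. Qed.
Definition denE := (den_seq, den_set, den_write, den_if, den_skip).

(** The Hoare rule for loops. The bound [m] lies within the cap, so the cut-off has no effect; the
    invariant is stated for the moment after the counter has been advanced. *)
Lemma den_for (I : nat -> state -> Prop) x y e b s m :
  expr_val s e = m -> m <= regs s capreg ->
  I 0 (set2 s x y m) ->
  (forall i st, i < m -> regs st x = i -> I i st -> I i.+1 (set_reg (den b st) x i.+1)) ->
  I m (den (PFor x y e b) s).
Proof.
move=> em mc I0 IS /=.
have -> : forbound s e = m by rewrite /forbound em; lia.
have [] // : I m (iteri m (fun i s' => set_reg (den b s') x i.+1) (set2 s x y m)) /\
  regs (iteri m (fun i s' => set_reg (den b s') x i.+1) (set2 s x y m)) x = m.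
apply: (@iteri_ind _ (fun i t => I i t /\ regs t x = i)).
  by rewrite /= eqxx.
by move=> i t im [It tx]; split; [apply: IS|rewrite /= eqxx].
Qed.

Arguments den : simpl never.

(** * Running a program in fresh memory *)

Notation Mreg := 7.
Notation Jreg := 9.

Definition addr (e : expr) : expr := Bin Add (Bin Mul e (Reg Mreg)) (Reg Jreg).

(** Simulated arrays get the even and simulated registers the odd offsets from [arr0]; a register
    becomes cell [j] of an array of its own. In this way the solver's registers, too, are zero
    before each run, and the registers of the calling program survive it. *)
Fixpoint hat_expr (e : expr) : expr :=
  match e with
  | Const k => Const k
  | Reg x => Read (arr0 + x.*2.+1) (Reg Jreg)
  | Read a e1 => Read (arr0 + a.*2) (addr (hat_expr e1))
  | Bin o e1 e2 => Bin o (hat_expr e1) (hat_expr e2)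
  end.

Fixpoint hat (p : cmd) : cmd :=
  match p with
  | Skip => Skip
  | Assign x e => Write (arr0 + x.*2.+1) (Reg Jreg) (hat_expr e)
  | Write a e1 e2 => Write (arr0 + a.*2) (addr (hat_expr e1)) (hat_expr e2)
  | Seq p1 p2 => Seq (hat p1) (hat p2)
  | If e p1 p2 => If (hat_expr e) (hat p1) (hat p2)
  | While e p1 => While (hat_expr e) (hat p1)
  end.

Definition sim (M j : nat) (s t : state) : Prop :=
  [/\ regs t Mreg = M, regs t Jreg = j,
      forall x, arrays t (arr0 + x.*2.+1) j = regs s x &
      forall a i, arrays t (arr0 + a.*2) (i * M + j) = arrays s a i].

(** Run [j] writes only to cells whose index is [j] modulo [M], so the residue classes of later runs
    are still zero. *)
Definition frame (M j : nat) (t t' : state) : Prop :=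
  regs t' =1 regs t /\
  forall a i, (a < arr0) || (i %% M != j) -> arrays t' a i = arrays t a i.

Lemma frame_trans M j t1 t2 t3 :
  frame M j t1 t2 -> frame M j t2 t3 -> frame M j t1 t3.
Proof. by move=> [r1 a1] [r2 a2]; split=> [x|a i h]; rewrite ?r2 ?r1 // a2 ?a1. Qed.

Section Hat.
Variables (M j L : nat).
Hypotheses (jM : j < M) (ML : bitlen M <= L).

Lemma jL : bitlen j <= L.
Proof. exact: leq_trans (bitlenS (ltnW jM)) ML. Qed.

Lemma hat_val s t e : sim M j s t -> expr_val t (hat_expr e) = expr_val s e.
Proof.
case=> hM hJ hr ha; elim: e => [k|x|a e1 IH|o e1 IH1 e2 IH2] //=.
- by rewrite hJ hr.
- by rewrite IH hM hJ ha.
- by rewrite IH1 IH2.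
Qed.

Lemma expr_cost_gt s e : bitlen (expr_val s e) <= expr_cost s e.
Proof. by case: e => *; apply: leq_addr. Qed.

Lemma addr_cost s t e : sim M j s t ->
  expr_cost t (addr (hat_expr e)) <=
  expr_cost t (hat_expr e) + 2 * bitlen (expr_val s e) + 5 * L.
Proof.
move=> st; case: (st) => hM hJ _ _; rewrite /= (hat_val _ st) hM hJ.
have := jL; have := bitlenM (expr_val s e) M.
have := bitlenD (expr_val s e * M) j; have : 0 < bitlen M by [].
move: ML; lia.
Qed.

(** The surplus [2 * bitlen (expr_val s e)] strengthens the induction: it is what an enclosing
    [Read] spends on multiplying this value by [M] and adding [j]. *)
Lemma hat_cost s t e : sim M j s t ->
  expr_cost t (hat_expr e) + 2 * bitlen (expr_val s e) <= 10 * L * expr_cost s e.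
Proof.
move=> st; have L0 : 0 < L by apply: leq_trans ML.
have key b : 0 < b -> 3 * b + 5 * L <= 10 * L * b by move=> ?; nia.
case: (st) => hM hJ hr ha; elim: e => [k|x|a e1 IH|o e1 IH1 e2 IH2].
- by have := key _ (bitlen_gt0 k); rewrite /=; lia.
- have := key _ (bitlen_gt0 (regs s x)); rewrite /= hJ hr; have := jL; lia.
- have := key _ (bitlen_gt0 (arrays s a (expr_val s e1))).
  have := addr_cost e1 st.
  set h := addr _.
  have -> : expr_cost t (hat_expr (Read a e1)) =
      bitlen (arrays t (arr0 + a.*2) (expr_val t h)) + expr_cost t h by [].
  have -> : expr_cost s (Read a e1) =
      bitlen (arrays s a (expr_val s e1)) + expr_cost s e1 by [].
  have -> : expr_val s (Read a e1) = arrays s a (expr_val s e1) by [].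
  rewrite mulnDr; have -> : expr_val t h = expr_val s e1 * M + j by rewrite /h /= (hat_val _ st) hM hJ.
  rewrite ha; move: IH; lia.
- have := key _ (bitlen_gt0 (expr_val s (Bin o e1 e2))).
  by move: IH1 IH2; rewrite /= !(hat_val _ st) !mulnDr; lia.
Qed.

Lemma hat_cost_le s t e : sim M j s t ->
  expr_cost t (hat_expr e) + 5 * L <= 15 * L * expr_cost s e.
Proof.
move=> st; have := hat_cost e st; have := expr_cost_gt s e.
have : 0 < bitlen (expr_val s e) by []. nia.
Qed.

Lemma addr_cost_le s t e : sim M j s t ->
  expr_cost t (addr (hat_expr e)) <= 15 * L * expr_cost s e.
Proof.
move=> st; have := hat_cost e st; have := expr_cost_gt s e; have := addr_cost e st.
have : 0 < bitlen (expr_val s e) by []. nia.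
Qed.

Lemma sim_reg s t x v : sim M j s t ->
  sim M j (set_reg s x v) (set_cell t (arr0 + x.*2.+1) j v).
Proof.
case=> hM hJ hr ha; split=> //= [y|a i].
  rewrite eqxx andbT eqn_add2l eqSS (inj_eq double_inj).
  by case: ifP => // _; apply: hr.
rewrite eqn_add2l ifN ?ha //; apply/negP=> /andP[/eqP h _].
by have := congr1 odd h; rewrite /= !odd_double.
Qed.

Lemma sim_cell s t a i v : sim M j s t ->
  sim M j (set_cell s a i v) (set_cell t (arr0 + a.*2) (i * M + j) v).
Proof.
case=> hM hJ hr ha; split=> //= [y|b k].
  rewrite eqn_add2l ifN ?hr //; apply/negP=> /andP[/eqP h _].
  by have := congr1 odd h; rewrite /= !odd_double.
rewrite eqn_add2l eqn_add2r (inj_eq double_inj) eqn_mul2r ha.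
by rewrite (_ : (M == 0) = false) //; apply/negbTE; lia.
Qed.

Lemma frame_cell t a i v : arr0 <= a -> i %% M = j -> frame M j t (set_cell t a i v).
Proof.
move=> aa ij; split=> // b k /=; case: (b =P a) => //= ->; case: (k =P i) => //= ->.
by rewrite ij eqxx orbF ltnNge aa.
Qed.

(** The slowdown is linear in the bit length of [M], hence affordable although [M] itself may be
    exponential. *)
Lemma hat_exec p s n s' : exec p s n s' -> forall t, sim M j s t ->
  exists n' t', [/\ exec (hat p) t n' t', sim M j s' t', n' <= 15 * L * n
                  & frame M j t t'].
Proof.
have L0 : 0 < L by apply: leq_trans ML.
have modj i : (i * M + j) %% M = j by rewrite modnMDl modn_small.
elim=> {p s n s'} /=.
- move=> s t st; exists 1, t; split=> //; [exact: ExecSkip|nia].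
- move=> s x e t st; exists (expr_cost t (Reg Jreg) + expr_cost t (hat_expr e)).
  exists (set_cell t (arr0 + x.*2.+1) j (expr_val s e)); split.
  + case: (st) => _ hJ _ _; have := ExecWrite t (arr0 + x.*2.+1) (Reg Jreg) (hat_expr e).
    by rewrite [expr_val t (Reg _)]hJ (hat_val _ st).
  + exact: sim_reg.
  + case: (st) => _ hJ _ _; have := hat_cost_le e st; rewrite /= hJ; have := jL; lia.
  + by apply: frame_cell; rewrite ?leq_addr ?modn_small.
- move=> s a e1 e2 t st.
  exists (expr_cost t (addr (hat_expr e1)) + expr_cost t (hat_expr e2)).
  exists (set_cell t (arr0 + a.*2) (expr_val s e1 * M + j) (expr_val s e2)); split.
  + have -> : expr_val s e1 * M + j = expr_val t (addr (hat_expr e1)).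
      by case: (st) => hM hJ _ _; rewrite /= hM hJ (hat_val _ st).
    rewrite -(hat_val _ st); exact: ExecWrite.
  + exact: sim_cell.
  + have := addr_cost_le e1 st; have := hat_cost_le e2 st; rewrite mulnDr; lia.
  + by apply: frame_cell; rewrite ?leq_addr.
- move=> p1 p2 s1 s2 s3 n1 n2 _ IH1 _ IH2 t1 st1.
  have [m1 [t2 [ex1 st2 c1 f1]]] := IH1 _ st1.
  have [m2 [t3 [ex2 st3 c2 f2]]] := IH2 _ st2.
  exists (m1 + m2), t3; split=> //; first exact: ExecSeq ex1 ex2.
    by rewrite mulnDr leq_add.
  exact: frame_trans f1 f2.
- move=> e p1 p2 s n s' _ IH t st.
  have [m [t' [ex st' c f]]] := IH _ st.
  exists (expr_cost t (hat_expr e) + m), t'; split=> //.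
    by apply: ExecIf; rewrite (hat_val _ st); case: ifP ex.
  have := hat_cost_le e st; rewrite mulnDr; lia.
- move=> e p s e0 t st; exists (expr_cost t (hat_expr e)), t; split=> //.
    by apply: ExecWhileStop; rewrite (hat_val _ st).
  have := hat_cost_le e st; lia.
- move=> e p s1 s2 s3 n1 n2 e0 _ IH1 _ IH2 t1 st1.
  have [m1 [t2 [ex1 st2 c1 f1]]] := IH1 _ st1.
  have [m2 [t3 [ex2 st3 c2 f2]]] := IH2 _ st2.
  exists (expr_cost t1 (hat_expr e) + m1 + m2), t3; split=> //.
  + by apply: ExecWhileStep ex1 ex2; rewrite (hat_val _ st1).
  + have := hat_cost_le e st1; rewrite !mulnDr; lia.
  + exact: frame_trans f1 f2.
Qed.

End Hat.

(** * From circuits to CNF formulas *)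

(** Guesses (base [K.+1]) and candidate clauses (base [2n]) are both enumerated by a counter whose
    digits, least significant first, are the entries. *)
Definition digits (b l c : nat) : seq nat := [seq (c %/ b ^ i) %% b | i <- iota 0 l].

Lemma size_digits b l c : size (digits b l c) = l.
Proof. by rewrite size_map size_iota. Qed.

Lemma modn_sub m b : m - m %/ b * b = m %% b.
Proof. by rewrite {1}(divn_eq m b) addKn. Qed.

Lemma digitsS b l c : digits b l.+1 c = (c %% b) :: digits b l (c %/ b).
Proof.
rewrite /digits /= expn0 divn1 -[1]addn0 iotaDl -map_comp; congr cons.
by apply: eq_map => i /=; rewrite add1n expnS divnMA.
Qed.

Lemma digits_lt b l c : 0 < b -> all (fun x => x < b) (digits b l c).
Proof. by move=> b0; apply/allP=> _ /mapP[i _ ->]; rewrite ltn_mod. Qed.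

Lemma digits_inj b l : 0 < b -> {in gtn (b ^ l) &, injective (digits b l)}.
Proof.
move=> b0; elim: l => [|l IH] c c'; rewrite !inE.
  by rewrite expn0 !ltnS !leqn0 => /eqP-> /eqP->.
rewrite expnSr -!ltn_divLR // => h h'; rewrite !digitsS => -[e /(IH _ _ h h') e'].
by rewrite (divn_eq c b) (divn_eq c' b) e e'.
Qed.

Lemma digits_surj b s : all (fun x => x < b) s ->
  exists2 c, c < b ^ size s & digits b (size s) c = s.
Proof.
elim: s => [|x s IH] /=; first by exists 0.
case/andP=> xb /IH [c cb e]; exists (c * b + x).
  by rewrite expnSr -ltn_divLR ?divnMDl ?(divn_small xb) ?addn0 //; apply: leq_ltn_trans xb.
rewrite digitsS modnMDl modn_small // divnMDl ?(divn_small xb) ?addn0 ?e //.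
exact: leq_ltn_trans xb.
Qed.

Lemma nth_flatten_sum (T : Type) (x0 : T) ss v i :
  v < size ss -> i < size (nth [::] ss v) ->
  nth x0 (flatten ss) (\sum_(0 <= u < v) size (nth [::] ss u) + i) = nth x0 (nth [::] ss v) i.
Proof.
elim: ss v => [|s ss IH] [|v] //=.
  by rewrite big_geq // nth_cat => _ ->.
rewrite ltnS => vs ile; rewrite big_nat_recl //= nth_cat -addnA ltnNge leq_addr /=.
by rewrite addKn IH.
Qed.

Lemma sum_count_blocks (a : pred nat) K s m :
  \sum_(b < m) count a (take K (drop (b * K) s)) = count a (take (m * K) s).
Proof.
elim: m => [|m IH]; first by rewrite big_ord0 mul0n take0.
by rewrite big_ord_recr /= IH mulSn [K + _]addnC takeD count_cat.
Qed.

Section Reduction.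
Variables (C : circuit) (K d : nat).
Let n := #|inputs C|.
Variable i0 : 'I_n.
Hypotheses (K0 : 0 < K) (depth_d : depth C <= d).

Definition vert (v : nat) : 'I_(nverts C) := insubd (output C) v.
Definition lab v := label (vert v).
Definition pr v : seq nat := map val (enum (preds (vert v))).
Definition fan v := size (pr v).
Definition ins : seq nat := map val (enum (inputs C)).
(** If [K] divides the fan-in, the last block is empty; it costs one more guess digit, which every
    tuple reports as bad unless it is 0. *)
Definition nblocks v := if K < fan v then (fan v %/ K).+1 else 0.
Definition base v := \sum_(0 <= u < v) nblocks u.
Definition block v b := take K (drop (b * K) (pr v)).

(* Values are three-valued: 0 is unknown, 1 is false and 2 is true.  The list
   tau codes a clause, and the partial assignment is the one falsifying it. *)
Definition rho (tau : seq nat) v :=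
  foldl (fun r c => if v == nth 0 ins c./2 then 2 - odd c else r) 0 tau.

Definition gsum gam v := \sum_(b < nblocks v) nth 0 gam (base v + b).

(** A big gate takes its value from the guess alone, so dependence on the inputs stops there. A
    small gate with an unknown predecessor is unknown even if the known ones would decide it; this
    is good enough, as definite values are claimed only for tuples that mention all relevant
    inputs. *)
Fixpoint tval (gam tau : seq nat) h v : nat :=
  if is_input (lab v) then rho tau v else
  if h is h'.+1 then
    if K < fan v then (gate_val (lab v) (gsum gam v) (fan v)).+1 else
    if has (fun u => tval gam tau h' u == 0) (pr v) then 0 else
    (gate_val (lab v) (count (fun u => tval gam tau h' u == 2) (pr v)) (fan v)).+1
  else 0.

(** A block with an unknown member is never bad: a tuple yields a clause only if it already
    determines the count that refutes the guess. *)
Definition badblock (f : nat -> nat) (gam : seq nat) v b :=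
  ~~ has (fun u => f u == 0) (block v b) &&
  (count (fun u => f u == 2) (block v b) != nth 0 gam (base v + b)).

Definition viol gam tau :=
  (tval gam tau d (output C) == 1) ||
  has (fun v => has (badblock (tval gam tau d) gam v) (iota 0 (nblocks v)))
    (iota 0 (nverts C)).

Definition dec (c : nat) : literal n := (insubd i0 c./2, odd c).

Definition width := K ^ d.+1.

Definition taus := [seq digits (n + n) width c | c <- iota 0 ((n + n) ^ width)].

Definition cnf_of gam : cnf n := [seq map dec tau | tau <- taus & viol gam tau].

Definition wft (tau : seq nat) := all (fun c => c < n + n) tau && (size tau == width).

Lemma n_gt0 : 0 < n. Proof. exact: leq_ltn_trans (ltn_ord i0). Qed.

Lemma mem_taus tau : (tau \in taus) = wft tau.
Proof.
have nn0 : 0 < n + n by rewrite addn_gt0 n_gt0.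
apply/mapP/andP => [[c _ ->]|[h /eqP e]].
  by rewrite digits_lt // size_digits.
have [c cl <-] := digits_surj h; exists c; last by rewrite e.
by rewrite mem_iota add0n -e.
Qed.

Lemma uniq_taus : uniq taus.
Proof.
have nn0 : 0 < n + n by rewrite addn_gt0 n_gt0.
rewrite map_inj_in_uniq ?iota_uniq // => c c'; rewrite !mem_iota !add0n => h h'.
exact: digits_inj.
Qed.

Lemma half_lt c : c < n + n -> c./2 < n.
Proof. by rewrite addnn ltn_half_double. Qed.

Lemma encode_dec c : c < n + n -> encode_literal (dec c) = c.
Proof.
move=> cn; rewrite /encode_literal /= val_insubd half_lt // addnC odd_double_half.
by [].
Qed.

Lemma encode_dec_clause tau : wft tau -> encode_clause (map dec tau) = width :: tau.
Proof.
case/andP=> /allP h /eqP e; rewrite /encode_clause size_map e -map_comp; congr cons.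
by rewrite -[RHS]map_id; apply/eq_in_map => c /h /encode_dec.
Qed.

Lemma encode_cnf_of gam : encode_cnf (cnf_of gam) =
  n :: count (viol gam) taus :: flatten [seq width :: tau | tau <- taus & viol gam tau].
Proof.
rewrite /encode_cnf size_map size_filter; congr [:: _, _ & flatten _]; rewrite -map_comp.
apply/eq_in_map => tau; rewrite mem_filter mem_taus => /andP[_ h] /=.
exact: encode_dec_clause.
Qed.

(** The encoded clause gives back its tuple, so distinct tuples yield distinct lists of literals,
    permuted ones included. *)
Lemma dcnf_cnf_of gam : dcnf width (cnf_of gam).
Proof.
apply/andP; split.
  rewrite map_inj_in_uniq ?filter_uniq ?uniq_taus // => t t'.
  rewrite !mem_filter !mem_taus => /andP[_ ht] /andP[_ ht'] e.
  have := encode_dec_clause ht; rewrite e (encode_dec_clause ht').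
  by case.
apply/allP=> Cl /mapP[t]; rewrite mem_filter mem_taus => /andP[_ /andP[_ /eqP e]] ->.
by rewrite size_map e.
Qed.

(** A tuple containing both literals of a variable is falsified by no [y]. Its clause is a
    tautology, so it does no harm that [rho] resolves the conflict arbitrarily. *)
Definition fals (y : nat -> bool) (tau : seq nat) := all (fun c => y c./2 != odd c) tau.

Lemma clause_sat (y : {ffun 'I_n -> bool}) (y' : nat -> bool) tau :
  (forall i, y i = y' (val i)) -> wft tau ->
  has (fun l : literal n => y l.1 == l.2) (map dec tau) = ~~ fals y' tau.
Proof.
move=> yy /andP[/allP h _]; rewrite /fals has_map -has_predC; apply: eq_in_has => c /h cn /=.
by rewrite negbK yy val_insubd half_lt.
Qed.

(** A clause fails at [y] exactly when [y] falsifies its tuple, so a model is a [y] none of whose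
    falsified tuples is a violation. Taking [y] on all naturals avoids ordinals in what follows. *)
Lemma cnf_satP gam :
  reflect (exists y : nat -> bool, forall tau, wft tau -> fals y tau -> ~~ viol gam tau)
    (cnf_sat (cnf_of gam)).
Proof.
apply: (iffP existsP) => [[y /allP h]|[y h]].
  exists (fun i => if insub i is Some j then y j else false) => tau wt ft.
  apply/negP=> vt; have /h : map dec tau \in cnf_of gam.
    by apply: map_f; rewrite mem_filter vt mem_taus.
  rewrite (clause_sat (y' := fun i => if insub i is Some j then y j else false)) ?ft //.
  by move=> i; rewrite valK.
exists [ffun i => y (val i)]; apply/allP => Cl /mapP[t].
rewrite mem_filter mem_taus => /andP[vt wt] ->.
rewrite (clause_sat (y' := y)) //; last by move=> i; rewrite ffunE.
by apply/negP=> ft; move: (h _ wt ft); rewrite vt.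
Qed.

(** * Correctness of the reduction *)

Lemma vertK (v : 'I_(nverts C)) : vert (val v) = v.
Proof. exact: valKd. Qed.

Lemma val_vert v : v < nverts C -> val (vert v) = v.
Proof. by move=> h; rewrite val_insubd h. Qed.

Lemma mem_pr v u : u \in pr v -> u < nverts C /\ wire (vert u) (vert v).
Proof.
case/mapP=> u'; rewrite mem_enum inE => w ->; split; first exact: ltn_ord.
by rewrite vertK.
Qed.

Lemma fanE v : fan v = #|preds (vert v)|.
Proof. by rewrite /fan size_map cardE. Qed.

Lemma mem_ins v : v < nverts C -> (v \in ins) = is_input (lab v).
Proof.
move=> vN; rewrite -[v in LHS]val_vert // mem_map; last exact: val_inj.
by rewrite mem_enum inE.
Qed.

Lemma size_ins : size ins = n.
Proof. by rewrite size_map -cardE. Qed.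

Lemma uniq_ins : uniq ins.
Proof. by rewrite map_inj_uniq ?enum_uniq //; apply: val_inj. Qed.

Lemma count_pr (f : pred 'I_(nverts C)) v :
  #|[set u in preds (vert v) | f u]| = count (fun u => f (vert u)) (pr v).
Proof.
rewrite count_map -sum1_card -sum1_count big_enum_cond /=.
by apply: eq_bigl => u; rewrite !inE vertK.
Qed.

Lemma eval_vert x v : Defs.eval x (vert v) =
  if is_input (lab v) then vert v \in x else
  gate_val (lab v) (count (fun u => Defs.eval x (vert u)) (pr v)) (fan v).
Proof. by rewrite evalE fanE count_pr. Qed.

(** Bounding the length of paths into [v] provides the induction measure that stands in for a
    topological order. *)
Definition hgt h v := forall q u, path (@wire C) u q -> last u q = vert v -> size q <= h.

Lemma hgt_d v : hgt d v.
Proof. by move=> q u uq _; apply: leq_trans (path_size_depth uq) depth_d. Qed.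

Lemma hgt_pr h v u : hgt h.+1 v -> u \in pr v -> hgt h u.
Proof.
move=> hv /mem_pr[_ uv] q w wq lq.
by have := hv (rcons q (vert v)) w; rewrite rcons_path wq lq uv last_rcons size_rcons; apply.
Qed.

Lemma hgt0 v : hgt 0 v -> is_input (lab v).
Proof.
move=> hv; rewrite /lab circuit_input cards_eq0; apply/eqP/setP => u; rewrite !inE.
by apply/negP=> uv; have := hv [:: vert v] u; rewrite /= uv => /(_ isT erefl).
Qed.

Lemma tval_stable gam tau h h' v : hgt h v -> h <= h' ->
  tval gam tau h' v = tval gam tau h v.
Proof.
elim: h h' v => [|h IH] [|h'] v hv //=; first by rewrite hgt0.
rewrite ltnS => hh; case: ifP => // _; case: ifP => // _.
have e u : u \in pr v -> tval gam tau h' u = tval gam tau h u.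
  by move/(hgt_pr hv)=> hu; apply: IH.
have -> : has (fun u => tval gam tau h' u == 0) (pr v) =
          has (fun u => tval gam tau h u == 0) (pr v).
  by apply: eq_in_has => u /e ->.
case: ifP => // _; congr (_ (gate_val _ _ _)).+1.
by apply: eq_in_count => u /e ->.
Qed.

Lemma nblocks_ge v : K < fan v -> fan v <= nblocks v * K.
Proof.
by move=> h; rewrite /nblocks h ltnW // -ltn_divLR.
Qed.

Definition honest_at gam x v := forall b, b < nblocks v ->
  nth 0 gam (base v + b) = count (fun u => Defs.eval x (vert u)) (block v b).

Lemma gsum_honest gam x v : honest_at gam x v -> K < fan v ->
  gsum gam v = count (fun u => Defs.eval x (vert u)) (pr v).
Proof.
move=> hon big; rewrite /gsum (eq_bigr (fun b : 'I_(nblocks v) =>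
  count (fun u => Defs.eval x (vert u)) (take K (drop (b * K) (pr v))))).
  by rewrite sum_count_blocks take_oversize // nblocks_ge.
by move=> b _; rewrite hon.
Qed.

Definition compat (x : {set 'I_(nverts C)}) (y : nat -> bool) :=
  forall v, v \in ins -> (vert v \in x) = y (index v ins).

(** Under [fals y tau] every entry gives its variable the value it has in [y], so repeated entries
    agree. The successor maps a Boolean to its code 1 or 2. *)
Lemma rhoP y tau v : wft tau -> fals y tau -> v \in ins ->
  (rho tau v = 0 \/ rho tau v = (y (index v ins)).+1) /\
  (index v ins \in map half tau -> rho tau v = (y (index v ins)).+1).
Proof.
case/andP=> h _; rewrite /rho => ft vin; move: h ft.
elim/last_ind: tau => [|t c IH]; first by split; [left|].
rewrite !all_rcons /= /fals all_rcons map_rcons mem_rcons inE => /andP[cn h] /andP[/= yc ft].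
rewrite -cats1 foldl_cat /=; case: eqP => [e|ne].
  have -> : index v ins = c./2 by rewrite e index_uniq ?uniq_ins ?size_ins ?half_lt.
  have -> : 2 - odd c = (y c./2).+1 by move: yc; case: (y _); case: odd.
  by split=> //; right.
have [IH1 IH2] := IH h ft; split=> // /orP[/eqP e|]; last exact: IH2.
by case: ne; rewrite -e nth_index.
Qed.

Lemma tval_sound gam x y tau h v :
  (forall u, u < nverts C -> honest_at gam x u) -> compat x y ->
  wft tau -> fals y tau -> v < nverts C ->
  tval gam tau h v = 0 \/ tval gam tau h v = (Defs.eval x (vert v)).+1.
Proof.
move=> hon xy wt ft; elim: h v => [|h IH] v vN.
  rewrite /= eval_vert; case: ifP => [iv|_]; last by left.
  have vin : v \in ins by rewrite mem_ins.
  by rewrite (xy _ vin); have [] := rhoP wt ft vin.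
rewrite /= eval_vert; case: ifP => [iv|_].
  have vin : v \in ins by rewrite mem_ins.
  by rewrite (xy _ vin); have [] := rhoP wt ft vin.
case: ifP => [big|_]; first by right; rewrite (gsum_honest (hon _ vN)).
case: ifP => [_|nh]; first by left.
right; congr (_ (gate_val _ _ _)).+1; apply: eq_in_count => u uv.
have [uN _] := mem_pr uv; have [e|->] := IH _ uN; last by case: Defs.eval.
by case/hasP: nh; exists u; rewrite ?e.
Qed.

Lemma mem_block v b u : u \in block v b -> u \in pr v.
Proof. by move/mem_take/mem_drop. Qed.

Lemma size_block v b : size (block v b) <= K.
Proof. by rewrite /block size_take; case: ltnP. Qed.

Lemma honest_guess x : exists gam, [/\ size gam = base (nverts C),
  all (fun g => g < K.+1) gam & forall u, u < nverts C -> honest_at gam x u].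
Proof.
pose g v := [seq count (fun u => Defs.eval x (vert u)) (block v b) | b <- iota 0 (nblocks v)].
have sg v : size (g v) = nblocks v by rewrite size_map size_iota.
exists (flatten [seq g v | v <- iota 0 (nverts C)]); split.
- rewrite size_flatten /shape -map_comp sumnE big_map /base /index_iota subn0.
  by apply: eq_bigr => v _ /=; rewrite sg.
- apply/allP=> c /flattenP[_ /mapP[v _ ->] /mapP[b _ ->]].
  by rewrite ltnS (leq_trans (count_size _ _)) ?size_block.
move=> v vN b bv.
have E u : u < nverts C -> nth [::] [seq g v | v <- iota 0 (nverts C)] u = g u.
  by move=> uN; rewrite (nth_map 0) ?size_iota // nth_iota.
have -> : base v = \sum_(0 <= u < v) size (nth [::] [seq g v | v <- iota 0 (nverts C)] u).
  rewrite /base !big_nat; apply: eq_bigr => u /andP[_ uv].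
  by rewrite E ?sg // (ltn_trans uv).
rewrite nth_flatten_sum ?E ?size_map ?size_iota ?sg //.
by rewrite (nth_map 0) ?size_iota // nth_iota.
Qed.

(** Take the honest guess of a satisfying input. By [tval_sound] every value that is not unknown is
    then the true one, so no determined block contradicts the guess and the output is never
    false. *)
Lemma circuit_sat_cnf : circuit_sat C -> exists gam,
  [/\ size gam = base (nverts C), all (fun g => g < K.+1) gam & cnf_sat (cnf_of gam)].
Proof.
case/existsP=> x /andP[_ ex]; have [gam [sg ag hon]] := honest_guess x.
exists gam; split=> //; apply/cnf_satP.
exists (fun i => vert (nth 0 ins i) \in x) => tau wt ft.
have xy : compat x (fun i => vert (nth 0 ins i) \in x).
  by move=> v vin; rewrite nth_index.
have snd := tval_sound d hon xy wt ft.
rewrite /viol negb_or; apply/andP; split.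
  have [->|->] // := snd _ (ltn_ord (output C)).
  by rewrite vertK ex.
apply/hasPn => v; rewrite mem_iota add0n => vN; apply/hasPn => b; rewrite mem_iota add0n => bv.
rewrite negb_and negbK; case: hasP => //= nh; rewrite negbK (hon _ vN _ bv); apply/eqP.
apply: eq_in_count => u ub; have [uN _] := mem_pr (mem_block ub).
have [e|->] := snd _ uN; last by case: Defs.eval.
by case: nh; exists u; rewrite ?e.
Qed.

(** With [P u S] meaning that the inputs in [S] determine [u], the union of the supports of all
    members of [s] determines them jointly. *)
Lemma cover_seq (P : nat -> seq nat -> Prop) A s :
  (forall u S S', P u S -> {subset S <= S'} -> P u S') ->
  (forall u, u \in s -> exists S, [/\ size S <= A, all (fun i => i < n) S & P u S]) ->
  exists S, [/\ size S <= size s * A, all (fun i => i < n) S & forall u, u \in s -> P u S].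
Proof.
move=> mono; elim: s => [|u s IH] h; first by exists [::].
have [S1 [z1 n1 p1]] := h u (mem_head _ _).
have [|S2 [z2 n2 p2]] := IH; first by move=> w ws; apply: h; rewrite inE ws orbT.
exists (S1 ++ S2); split.
- by rewrite size_cat mulSn leq_add.
- by rewrite all_cat n1.
move=> w; rewrite inE => /orP[/eqP ->|/p2 pw].
  by apply: mono p1 _ => i; rewrite mem_cat => ->.
by apply: mono pw _ => i; rewrite mem_cat => ->; rewrite orbT.
Qed.

Lemma tau_of y S : all (fun i => i < n) S -> size S <= width ->
  exists tau, [/\ wft tau, fals y tau & {subset S <= map half tau}].
Proof.
(* Tuples have exactly [width] entries, so [S] is padded with input 0. The literal of [i] that [y]
   falsifies has sign [~~ y i]. *)
move=> Sn Sw; pose S' := S ++ nseq (width - size S) 0.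
have Sn' : all (fun i => i < n) S' by rewrite all_cat Sn all_nseq n_gt0 orbT.
have hf i : (~~ y i + i.*2)./2 = i by rewrite half_bit_double.
exists [seq ~~ y i + i.*2 | i <- S']; split.
- rewrite /wft size_map size_cat size_nseq subnKC // eqxx andbT all_map.
  by apply: sub_all Sn' => i /=; case: (y i) => /=; rewrite -addnn; lia.
- by apply/allP=> _ /mapP[i _ ->]; rewrite hf oddD odd_double addbF; case: (y i).
rewrite -map_comp => i iS /=; apply/mapP; exists i; last by rewrite /= hf.
by rewrite mem_cat iS.
Qed.

(** When no tuple falsified by [y] is a violation, the guess must be right for the input given by
    [y], and then few inputs determine each value. Both facts share one induction on the height,
    because a guess can be tested only on a block whose members are already determined. *)
Lemma known gam x y h v : compat x y ->
  (forall tau, wft tau -> fals y tau -> ~~ viol gam tau) ->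
  h <= d -> hgt h v -> v < nverts C ->
  exists S, [/\ size S <= K ^ h, all (fun i => i < n) S &
    forall tau, wft tau -> fals y tau -> {subset S <= map half tau} ->
      tval gam tau d v = (Defs.eval x (vert v)).+1].
Proof.
move=> xy nv; elim: h v => [|h IH] v hd hv vN.
all: case: (boolP (is_input (lab v))) => [iv|niv].
- have vin : v \in ins by rewrite mem_ins.
  exists [:: index v ins]; split; first by rewrite /= expn_gt0 K0.
    by rewrite /= -size_ins index_mem vin.
  move=> tau wt ft /(_ _ (mem_head _ _)) m; rewrite eval_vert iv (xy _ vin).
  by have [_ /(_ m) <-] := rhoP wt ft vin; case: (d) => [|?] /=; rewrite iv.
- by rewrite hgt0 in niv.
- have vin : v \in ins by rewrite mem_ins.
  exists [:: index v ins]; split; first by rewrite /= expn_gt0 K0.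
    by rewrite /= -size_ins index_mem vin.
  move=> tau wt ft /(_ _ (mem_head _ _)) m; rewrite eval_vert iv (xy _ vin).
  by have [_ /(_ m) <-] := rhoP wt ft vin; case: (d) => [|?] /=; rewrite iv.
pose P u (S : seq nat) := forall tau, wft tau -> fals y tau -> {subset S <= map half tau} ->
      tval gam tau d u = (Defs.eval x (vert u)).+1.
have mono u S S' : P u S -> {subset S <= S'} -> P u S'.
  by move=> p sub tau wt ft sub'; apply: p => // i /sub /sub'.
have cov u : u \in pr v -> exists S, [/\ size S <= K ^ h, all (fun i => i < n) S & P u S].
  by move=> uv; apply: IH; [exact: ltnW|exact: hgt_pr uv|case: (mem_pr uv)].
have hK : K * K ^ h <= width by rewrite -expnS /width leq_pexp2l // ltnS ltnW.
case: (ltnP K (fan v)) => [big|small].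
  (* The value comes from the guess, so the empty support works once the guess is honest at [v].
     Each block is determined by at most [K * K ^ h <= width] inputs; a tuple mentioning them is no
     violation and thereby confirms the guessed count. *)
  exists [::]; split=> // tau wt ft _.
  rewrite (tval_stable _ _ hv) //= eval_vert (negbTE niv) big (@gsum_honest _ x) //.
  move=> b bv.
  have [u ub|S [zS nS pS]] := cover_seq mono (A := K ^ h) (s := block v b).
    by apply: cov; apply: mem_block ub.
  have [|t [wt' ft' sub]] := tau_of y nS.
    by apply: leq_trans zS _; apply: leq_trans hK; rewrite leq_mul2r size_block orbT.
  have := nv _ wt' ft'; rewrite negb_or => /andP[_ /hasPn/(_ v)].
  rewrite mem_iota add0n => /(_ vN) /hasPn/(_ b); rewrite mem_iota add0n => /(_ bv).
  have e u : u \in block v b -> tval gam t d u = (Defs.eval x (vert u)).+1.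
    by move=> ub; apply: pS.
  rewrite negb_and !negbK => /orP[/hasP[u ub]|/eqP <-]; first by rewrite e.
  by apply: eq_in_count => u /e ->; case: Defs.eval.
have [S [zS nS pS]] := cover_seq mono cov.
exists S; split=> //.
  by apply: leq_trans zS _; rewrite expnS leq_mul2r small orbT.
move=> tau wt ft sub.
have e u : u \in pr v -> tval gam tau h u = (Defs.eval x (vert u)).+1.
  move=> uv; rewrite -(pS _ uv tau wt ft sub).
  by rewrite (tval_stable _ _ (hgt_pr hv uv)) // ltnW.
rewrite (tval_stable _ _ hv) //= eval_vert (negbTE niv) ltnNge small /=.
rewrite ifN; last by apply/hasPn=> u /e ->.
by congr (_ (gate_val _ _ _)).+1; apply: eq_in_count => u /e ->; case: Defs.eval.
Qed.

Lemma cnf_circuit_sat gam : cnf_sat (cnf_of gam) -> circuit_sat C.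
Proof.
case/cnf_satP=> y nv.
pose x := [set v in inputs C | y (index (val v) ins)].
have xy : compat x y.
  move=> v vin; have vN : v < nverts C by case/mapP: vin => u _ ->; apply: ltn_ord.
  by rewrite inE inE -/(lab v) -mem_ins // vin val_vert.
have [S [zS nS pS]] := known xy nv (leqnn d) (@hgt_d (output C)) (ltn_ord (output C)).
have [|t [wt ft sub]] := tau_of y nS.
  by apply: leq_trans zS _; rewrite /width leq_pexp2l.
have := nv _ wt ft; rewrite negb_or pS // vertK => /andP[e _].
apply/existsP; exists x; apply/andP; split; last by move: e; case: Defs.eval.
by apply/fintype.subsetP=> v; rewrite inE => /andP[].
Qed.

Definition guess j := digits K.+1 (base (nverts C)) j.

Lemma circuit_satE : circuit_sat C =
  has (fun j => cnf_sat (cnf_of (guess j))) (iota 0 (K.+1 ^ base (nverts C))).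
Proof.
apply/idP/hasP => [|[j _]]; last exact: cnf_circuit_sat.
case/circuit_sat_cnf=> gam [sg /digits_surj[j jl e] h].
by exists j; rewrite ?mem_iota ?add0n -?sg // /guess -sg e.
Qed.

(** * Layout of the circuit code and number of blocks *)

Definition off v := 2 + \sum_(0 <= u < v) (3 + fan u).

Lemma nth_encode v i : v < nverts C -> i < 3 + fan v ->
  nth 0 (encode_circuit C) (off v + i) =
  nth 0 [:: gate_code (lab v), threshold (lab v), fan v & pr v] i.
Proof.
move=> vN iv; rewrite /off -addnA /=.
set ss := map _ _.
have E u : u < nverts C -> nth [::] ss u = encode_gate (vert u).
  move=> uN; rewrite (nth_map (output C)) ?size_enum_ord //; congr encode_gate.
  by apply: val_inj; rewrite /= nth_enum_ord // val_vert.
have sE u : size (encode_gate (vert u)) = 3 + fan u by rewrite /= /fan !size_map.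
have -> : \sum_(0 <= u < v) (3 + fan u) = \sum_(0 <= u < v) size (nth [::] ss u).
  rewrite !big_nat; apply: eq_bigr => u /andP[_ uv].
  by rewrite E ?sE // (ltn_trans uv).
rewrite add0n nth_flatten_sum; [|by rewrite size_map size_enum_ord|by rewrite E // sE].
by rewrite E // /encode_gate -fanE.
Qed.

Lemma size_encode : size (encode_circuit C) = off (nverts C).
Proof.
rewrite /off /= size_flatten /shape -map_comp sumnE big_map big_enum /= add2n big_mkord.
by congr _.+2; apply: eq_bigr => v _; rewrite size_map -cardE fanE vertK.
Qed.

Lemma leq_base u v : u <= v -> base u <= base v.
Proof. by move=> uv; rewrite /base (big_cat_nat_idem _ _ uv) ?leq_addr. Qed.

Lemma base_lt v b : v < nverts C -> b < nblocks v -> base v + b < base (nverts C).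
Proof.
move=> vN bv; apply: leq_trans (leq_base vN).
by rewrite /base big_nat_recr //= ltn_add2l.
Qed.

Lemma off_lt v i : v < nverts C -> i < 3 + fan v -> off v + i < size (encode_circuit C).
Proof.
move=> vN iv; rewrite size_encode /off -addnA ltn_add2l.
apply: (@leq_trans (\sum_(0 <= u < v.+1) (3 + fan u))).
  by rewrite big_nat_recr //= ltn_add2l.
by rewrite (big_cat_nat _ vN) //= leq_addr.
Qed.

Lemma fan_size v : v < nverts C -> fan v < size (encode_circuit C).
Proof.
move=> vN; apply: leq_ltn_trans (off_lt vN (_ : 2 + fan v < 3 + fan v)) => //.
by rewrite addnA leq_addl.
Qed.

Lemma nverts_size : nverts C < size (encode_circuit C).
Proof.
rewrite size_encode /off; apply: (@leq_ltn_trans (1 + \sum_(0 <= u < nverts C) 1)).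
  by rewrite sum_nat_const_nat subn0 muln1 leq_addl.
by rewrite -addSn leq_add2l leq_sum.
Qed.

Lemma wires_fan : wires C = \sum_(0 <= v < nverts C) fan v.
Proof.
rewrite big_mkord /wires (eq_bigr (fun v : 'I_(nverts C) => #|preds v|)); last first.
  by move=> v _; rewrite fanE vertK.
rewrite -sum1_card (eq_bigl (fun uv : 'I_(nverts C) * 'I_(nverts C) => wire uv.1 uv.2)).
  rewrite -(pair_big_dep xpredT (fun u v => wire u v) (fun _ _ => 1)) /=.
  rewrite (exchange_big_dep xpredT) //=; apply: eq_bigr => v _.
  by rewrite -sum1_card; apply: eq_bigl => u; rewrite inE.
by move=> uv; rewrite inE.
Qed.

(* Only gates of fan-in more than K have blocks, so rounding up at most
   doubles the number of blocks. *)
Lemma base_wires : K * base (nverts C) <= 2 * wires C.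
Proof.
rewrite wires_fan /base !big_distrr /=; apply: leq_sum => v _; rewrite /nblocks.
case: ifP => [h|_]; last by rewrite muln0.
by rewrite mulnS mul2n -addnn leq_add // ?(ltnW h) // mulnC leq_trunc_div.
Qed.

Lemma base_size : base (nverts C) <= 2 * size (encode_circuit C).
Proof.
apply: (@leq_trans (K * base (nverts C))); first by rewrite leq_pmull.
rewrite (leq_trans base_wires) // leq_mul2l wires_fan size_encode /off.
by rewrite (leq_trans _ (leq_addl _ _)) // leq_sum // => v _; apply: leq_addl.
Qed.

Lemma ins_size : n < size (encode_circuit C).
Proof.
by apply: leq_ltn_trans nverts_size; rewrite -[X in _ <= X]card_ord max_card.
Qed.

(** Fuel [d] covers every height, so the values satisfy the evaluation equations with no fuel left
    in them. This lets the program recompute values in place. *)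
Lemma tvalE gam tau v : tval gam tau d v =
  if is_input (lab v) then rho tau v else
  if K < fan v then (gate_val (lab v) (gsum gam v) (fan v)).+1 else
  if has (fun u => tval gam tau d u == 0) (pr v) then 0 else
  (gate_val (lab v) (count (fun u => tval gam tau d u == 2) (pr v)) (fan v)).+1.
Proof.
have := @hgt_d v; case: d => [|d'] hv; first by rewrite /= hgt0.
have e u : u \in pr v -> tval gam tau d'.+1 u = tval gam tau d' u.
  by move=> uv; apply: tval_stable (hgt_pr hv uv) (leqnSn _).
rewrite {1}/tval -/tval; do 2![case: ifP => // _].
have -> : has (fun u => tval gam tau d'.+1 u == 0) (pr v) =
          has (fun u => tval gam tau d' u == 0) (pr v).
  by apply: eq_in_has => u /e ->.
case: ifP => // _; congr (_ (gate_val _ _ _)).+1.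
by apply: eq_in_count => u /e ->.
Qed.

End Reduction.

(** * The reduction as a loop program *)

Notation "e1 [+] e2" := (Bin Add e1 e2) (at level 50, left associativity).
Notation "e1 [-] e2" := (Bin Defs.Sub e1 e2) (at level 50, left associativity).
Notation "e1 [*] e2" := (Bin Mul e1 e2) (at level 40, left associativity).
Notation "e1 [/] e2" := (Bin Div e1 e2) (at level 40, left associativity).
Notation "e1 [=] e2" := (Bin Equal e1 e2) (at level 70, no associativity).
Notation "e1 [<] e2" := (Bin Less e1 e2) (at level 70, no associativity).
Notation "p ;; q" := (PSeq p q) (at level 90, right associativity).

(* Register conventions: 1 the loop cap, 2 number of vertices, 3 output,
   4 number n of inputs, 5 number 2n of literals, 6 number of blocks, 7 number
   of guesses, 8 number of candidate clauses, 9 current guess, 10 result,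
   19 digit base K+1 of the guesses, 40 clause width.
   Array conventions: 0 circuit, 1 offset of a vertex in the circuit code,
   2 index of the first block of a vertex, 3 input vertices, 4 guess,
   5 clause, 6 values of the vertices, 7 and 8 memory of the SAT solver. *)

Definition cnt_body :=
  PSet 22 (Read 6 (Read 0 (Reg 20 [+] Reg 35)));;
  PSet 13 (Reg 13 [+] (Reg 22 [=] Const 2));;
  PSet 14 (Reg 14 [+] (Reg 22 [=] Const 0)).

(** Scans the stretch of array 0 that starts at register 20 and has the length in register 21;
    registers 13 and 14 count its true and its unknown vertices. *)
Definition cntp :=
  PSet 13 (Const 0);; PSet 14 (Const 0);; PFor 35 36 (Reg 21) cnt_body.

Lemma cntp_spec s sub :
  regs s 21 = size sub -> size sub <= regs s capreg ->
  (forall i, i < size sub -> arrays s 0 (regs s 20 + i) = nth 0 sub i) ->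
  regs (den cntp s) 13 = count (fun u => arrays s 6 u == 2) sub /\
  regs (den cntp s) 14 = count (fun u => arrays s 6 u == 0) sub.
Proof.
move=> h21 cap h; rewrite /cntp !denE.
pose I i st := [/\ regs st 13 = count (fun u => arrays s 6 u == 2) (take i sub),
  regs st 14 = count (fun u => arrays s 6 u == 0) (take i sub),
  regs st 20 = regs s 20, arrays st 0 = arrays s 0 & arrays st 6 = arrays s 6].
set s1 := set_reg _ 14 _.
have [] // : I (size sub) (den (PFor 35 36 (Reg 21) cnt_body) s1); last first.
  by rewrite take_size.
apply: den_for => //; first by rewrite /I take0.
move=> i st im e35 [e13 e14 e20 a0 a6]; rewrite /cnt_body !denE.
split=> //=; rewrite ?(take_nth 0 im) -?cats1 ?count_cat /= ?a0 ?a6 e35 e20 h //.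
  by rewrite e13 addn0.
by rewrite e14 addn0.
Qed.

(** A product of two registers is not an [additive_expr], so powers are built by repeated
    addition. *)
Definition pow_body dst rb :=
  PSet 39 (Const 0);; PFor 27 28 (Reg rb) (PSet 39 (Reg 39 [+] Reg dst));;
  PSet dst (Reg 39).

Definition pow dst rb rl :=
  PSet dst (Const 1);; PFor 37 38 (Reg rl) (pow_body dst rb).

Lemma pow_spec dst rb rl s :
  uniq [:: dst; rb; rl; 1; 27; 28; 37; 38; 39] ->
  regs s rb <= regs s capreg -> regs s rl <= regs s capreg ->
  regs (den (pow dst rb rl) s) dst = regs s rb ^ regs s rl.
Proof.
rewrite /= !inE !negb_or -!andbA => /and5P[d1 d2 d3 d4 /and5P[d5 d6 d7 d8]].
move=> /and5P[r1 r2 r3 r4 /and5P[r5 r6 r7 l1 /and5P[l2 l3 l4 l5 /andP[l6 _]]]] cb cl.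
have E := (negbTE d1, negbTE d2, negbTE d3, negbTE d4, negbTE d5, negbTE d6,
  negbTE d7, negbTE d8, negbTE r2, negbTE r3, negbTE r4, negbTE r5, negbTE r6,
  negbTE r7, negbTE l4, negbTE l5, eqxx).
have E1 : (rb == dst) = false by rewrite eq_sym E.
have E2 : (rl == dst) = false by rewrite eq_sym E.
have E3 : (1 == dst) = false by rewrite eq_sym E.
rewrite /pow !denE; set s1 := set_reg _ dst _.
pose I i st := [/\ regs st dst = regs s rb ^ i, regs st rb = regs s rb
   & regs st capreg = regs s capreg].
have [] // : I (regs s rl) (den (PFor 37 38 (Reg rl) (pow_body dst rb)) s1).
apply: den_for.
- by rewrite /= E2.
- by rewrite /= E3.
- by rewrite /I /= !(E, E1, E3).
move=> i st il e37 [ed er ec]; rewrite /pow_body !denE.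
set s2 := set_reg st 39 _.
pose I2 u t := [/\ regs t 39 = u * regs s rb ^ i, regs t dst = regs s rb ^ i,
  regs t rb = regs s rb & regs t capreg = regs s capreg].
have [] : I2 (regs s rb) (den (PFor 27 28 (Reg rb) (PSet 39 (Reg 39 [+] Reg dst))) s2).
  apply: den_for.
  - by rewrite /= E.
  - by rewrite /= ec.
  - by rewrite /I2 /= !E.
  move=> u t ur e27 [f39 fd fr fc]; rewrite !denE.
  by rewrite /I2 /= f39 fd !E mulSn addnC.
move=> f39 fd fr fc.
by rewrite /I /= !(E, E1, E3) f39 expnS.
Qed.

Definition decode_body rb arr :=
  PWrite arr (Reg 37) (Reg 12 [-] ((Reg 12 [/] Reg rb) [*] Reg rb));;
  PSet 12 (Reg 12 [/] Reg rb).

Definition decode src rb rl arr :=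
  PSet 12 (Reg src);; PFor 37 38 (Reg rl) (decode_body rb arr).

Lemma decode_spec src rb rl arr s :
  rb \notin [:: 12; 37; 38] -> rl != 12 -> regs s rl <= regs s capreg ->
  forall i, i < regs s rl ->
  arrays (den (decode src rb rl arr) s) arr i =
  nth 0 (digits (regs s rb) (regs s rl) (regs s src)) i.
Proof.
rewrite !inE !negb_or => /and3P[b1 b2 b3] l1 cap.
rewrite /decode !denE; set s1 := set_reg _ 12 _.
pose I k st := [/\ regs st 12 = regs s src %/ regs s rb ^ k, regs st rb = regs s rb
   & forall i, i < k -> arrays st arr i = (regs s src %/ regs s rb ^ i) %% regs s rb].
have [_ _ h] : I (regs s rl) (den (PFor 37 38 (Reg rl) (decode_body rb arr)) s1).
  apply: den_for => //.
  - by rewrite /= (negbTE l1).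
  - by split=> //=; rewrite ?expn0 ?divn1 ?(negbTE b1) ?(negbTE b2) ?(negbTE b3).
  move=> k st kl e37 [e12 er h]; rewrite /decode_body !denE; split=> /=.
  - by rewrite e12 er expnSr divnMA.
  - by rewrite (negbTE b1) (negbTE b2).
  move=> i; rewrite ltnS leq_eqVlt eqxx /= e37 e12 er => /orP[/eqP ->|ik].
    by rewrite eqxx modn_sub.
  by rewrite h // ifN // (ltn_eqF ik).
by move=> i il; rewrite h // (nth_map 0) ?size_iota // nth_iota.
Qed.

Lemma iota_rcons m l : iota m l.+1 = rcons (iota m l) (m + l).
Proof. by rewrite -addn1 iotaD cats1. Qed.

Lemma set_nth_size (u : seq nat) v : set_nth 0 u (size u) v = rcons u v.
Proof. by elim: u => //= x u ->. Qed.

Section Program.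
Variables (C : circuit) (K d : nat).
Let n := #|inputs C|.
Variable i0 : 'I_n.
Hypotheses (K0 : 0 < K) (depth_d : depth C <= d).
Local Notation w := (encode_circuit C).
Local Notation N := (nverts C).
Local Notation lab := (lab C).
Local Notation pr := (pr C).
Local Notation fan := (fan C).
Local Notation ins := (ins C).
Local Notation nblocks := (nblocks C K).
Local Notation base := (base C K).
Local Notation off := (off C).
Local Notation width := (width K d).
Local Notation Q := ((n + n) ^ width).
Local Notation M := (K.+1 ^ base N).

(** Enough for every loop except the one over the [Q] candidate clauses. As [Q] is known only after
    parsing, the cap is then raised to [cap0 + Q]. *)
Definition cap0 := 2 * size w + (K + width + d + 3).

Lemma nth_code v : v < N -> nth 0 w (off v) = gate_code (lab v).
Proof. by move=> vN; have := @nth_encode C v 0 vN isT; rewrite addn0. Qed.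

Lemma nth_thr v : v < N -> nth 0 w (off v + 1) = threshold (lab v).
Proof. by move=> vN; exact: (@nth_encode C v 1 vN isT). Qed.

Lemma nth_fan v : v < N -> nth 0 w (off v + 2) = fan v.
Proof. by move=> vN; exact: (@nth_encode C v 2 vN isT). Qed.

Lemma nth_pr v i : v < N -> i < fan v -> nth 0 w (off v + 3 + i) = nth 0 (pr v) i.
Proof.
by move=> vN iv; rewrite -addnA nth_encode ?ltn_add2l.
Qed.

Record env (j : nat) (s : state) : Prop := Env {
  env_cap : cap0 <= regs s 1;
  env_N : regs s 2 = N;
  env_out : regs s 3 = output C;
  env_n : regs s 4 = n;
  env_n2 : regs s 5 = n + n;
  env_B : regs s 6 = base N;
  env_M : regs s 7 = M;
  env_Q : regs s 8 = Q;
  env_capQ : Q <= regs s 1;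
  env_J : regs s 9 = j;
  env_K : regs s 19 = K.+1;
  env_W : regs s 40 = width;
  env_w : forall i, arrays s 0 i = nth 0 w i;
  env_off : forall v, v < N -> arrays s 1 v = off v;
  env_base : forall v, v < N -> arrays s 2 v = base v;
  env_ins : forall i, i < n -> arrays s 3 i = nth 0 ins i
}.

(** Reduces preservation of [env] to a check on the syntax, settled by computation. *)
Definition keeps p :=
  all (fun x => ~~ setsreg p x) [:: 1; 2; 3; 4; 5; 6; 7; 8; 9; 19; 40] &&
  all (fun a => ~~ setsarr p a) [:: 0; 1; 2; 3].

Lemma env_den j p s : keeps p -> env j s -> env j (den p s).
Proof.
move=> /andP[/allP kr /allP ka] [h1 h2 h3 h4 h5 h6 h7 h8 h8' h9 h10 h11 h12 h13 h14 h15].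
by split; rewrite ?den_regs ?den_arrays ?kr ?ka //; move=> *; rewrite ?den_arrays ?ka //; auto.
Qed.

Lemma env_set j x v s : x \notin [:: 1; 2; 3; 4; 5; 6; 7; 8; 9; 19; 40] ->
  env j s -> env j (set_reg s x v).
Proof.
move=> xn; apply: (@env_den _ (PSet x (Const v))); rewrite /keeps andbT.
by apply/allP=> y /= yin; apply: contra xn => /eqP <-.
Qed.

Lemma env_cell j a i v s : a \notin [:: 0; 1; 2; 3] ->
  env j s -> env j (set_cell s a i v).
Proof.
move=> an; apply: (@env_den _ (PWrite a (Const i) (Const v))); rewrite /keeps /=.
by rewrite !inE !negb_or in an; rewrite ![_ == a]eq_sym andbT.
Qed.

Lemma N_cap : N.+2 <= cap0. Proof. have := nverts_size C; rewrite /cap0; lia. Qed.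

Lemma fan_cap v : v < N -> fan v + 2 <= cap0.
Proof. by move=> vN; have := fan_size vN; rewrite /cap0; lia. Qed.

Lemma base_cap : base N <= cap0.
Proof. by have := base_size C K0; rewrite /cap0; lia. Qed.

Lemma n2_cap : n + n <= cap0.
Proof. by have := ins_size C; rewrite /cap0 -/n; lia. Qed.

(** * Evaluating and checking the circuit *)

Definition guessed (gam : seq nat) s := forall i, i < base N -> arrays s 4 i = nth 0 gam i.

Definition big_body := PSet 13 (Reg 13 [+] Read 4 (Read 2 (Reg 23) [+] Reg 29)).

Definition bigsum :=
  PSet 13 (Const 0);; PSet 14 (Const 0);;
  PFor 29 30 ((Reg 15 [/] Const K) [+] Const 1) big_body.

Lemma bigsum_spec j gam s v : env j s -> guessed gam s -> v < N -> regs s 23 = v ->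
  regs s 15 = fan v -> K < fan v ->
  regs (den bigsum s) 13 = gsum C K gam v /\ regs (den bigsum s) 14 = 0.
Proof.
move=> es gs vN e23 e15 big; rewrite /bigsum !denE; set s1 := set_reg _ 14 _.
pose I b st := [/\ regs st 13 = \sum_(i < b) nth 0 gam (base v + i), regs st 14 = 0,
  regs st 23 = v, arrays st 2 = arrays s 2 & arrays st 4 = arrays s 4].
have bE : (fan v %/ K).+1 = nblocks v by rewrite /nblocks big.
have [] // : I (nblocks v) (den (PFor 29 30 ((Reg 15 [/] Const K) [+] Const 1) big_body) s1).
apply: den_for.
- by rewrite -bE /= e15 addn1.
- apply: leq_trans (env_cap es); have := fan_cap vN; rewrite -bE.
  have := leq_div (fan v) K; lia.
- by rewrite /I big_ord0.
move=> b st bl e29 [e13 e14 f23 a2 a4]; rewrite /big_body !denE; split=> //=.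
rewrite big_ord_recr /= e13 a4 a2 f23 e29 (env_base es vN) gs //.
exact: base_lt.
Qed.

Definition prsum := PSet 20 (Reg 11 [+] Const 3);; PSet 21 (Reg 15);; cntp.

Lemma prsum_spec j s v : env j s -> v < N -> regs s 11 = off v -> regs s 15 = fan v ->
  regs (den prsum s) 13 = count (fun u => arrays s 6 u == 2) (pr v) /\
  regs (den prsum s) 14 = count (fun u => arrays s 6 u == 0) (pr v).
Proof.
move=> es vN e11 e15; rewrite /prsum !denE; set s1 := set_reg _ 21 _.
have [] := @cntp_spec s1 (pr v) => //=.
- by apply: leq_trans (env_cap es); have := fan_cap vN; rewrite /fan; lia.
- by move=> i il; rewrite (env_w es) e11 nth_pr.
Qed.

(** Conjunction is a sum equal to 2, and disjunction is a plain sum because at most one gate code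
    matches. [theta <= m] is tested as [theta < m + 1]. *)
Definition gate_expr :=
  let both e1 e2 := (e1 [+] e2) [=] Const 2 in
  let code c := Read 0 (Reg 11) [=] Const c in
  both (code 1) (Reg 13 [=] Const 0) [+] both (code 2) (Reg 13 [=] Reg 15) [+]
  both (code 3) (Const 0 [<] Reg 13) [+]
  both (code 4) (Read 0 (Reg 11 [+] Const 1) [<] (Reg 13 [+] Const 1)).

Lemma gate_expr_val s g : arrays s 0 (regs s 11) = gate_code g ->
  arrays s 0 (regs s 11 + 1) = threshold g -> ~~ is_input g ->
  expr_val s gate_expr = gate_val g (regs s 13) (regs s 15).
Proof.
rewrite /= => -> ->; case: g => //= [_|_|_|th _]; rewrite ?addn0 ?add0n.
all: rewrite addn1 ?ltnS; case: (_ == 0); case: (_ == regs s 15); case: (0 < _) => //.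
all: by case: (_ <= _).
Qed.

(** Input gates have code 0 and keep the value of the partial assignment. [bigsum] clears register
    14, so a big gate never counts as unknown. *)
Definition gatev :=
  PSet 11 (Read 1 (Reg 23));; PSet 15 (Read 0 (Reg 11 [+] Const 2));;
  PIf (Read 0 (Reg 11))
    (PIf (Const K [<] Reg 15) bigsum prsum;;
     PIf (Reg 14) (PWrite 6 (Reg 23) (Const 0))
       (PWrite 6 (Reg 23) (Const 1 [+] gate_expr)))
    PSkip.

Definition newval gam (f : nat -> nat) v :=
  if K < fan v then (gate_val (lab v) (gsum C K gam v) (fan v)).+1 else
  if has (fun u => f u == 0) (pr v) then 0 else
  (gate_val (lab v) (count (fun u => f u == 2) (pr v)) (fan v)).+1.

Lemma gatev_spec j gam s v : env j s -> guessed gam s -> v < N -> regs s 23 = v ->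
  forall u, arrays (den gatev s) 6 u =
    if (u == v) && ~~ is_input (lab v) then newval gam (arrays s 6) v else arrays s 6 u.
Proof.
move=> es gs vN e23 u; rewrite /gatev 2!denE.
set s1 := den (PSet 15 _) _.
have s1E : s1 = set_reg (set_reg s 11 (off v)) 15 (fan v).
  rewrite /s1 !denE /=; congr (set_reg (set_reg _ _ _) _ _); rewrite ?e23 ?(env_off es) //.
  by rewrite (env_w es) nth_fan.
clearbody s1; rewrite den_if.
have es1 : env j s1 by rewrite s1E; do 2![apply: env_set => //].
have e11 : regs s1 11 = off v by rewrite s1E.
have e15 : regs s1 15 = fan v by rewrite s1E.
have f23 : regs s1 23 = v by rewrite s1E.
have a6 : arrays s1 6 = arrays s 6 by rewrite s1E.
have gs1 : guessed gam s1 by rewrite s1E.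
have -> : expr_val s1 (Read 0 (Reg 11)) = gate_code (lab v).
  by rewrite /= e11 (env_w es1) nth_code.
have -> : (gate_code (lab v) != 0) = ~~ is_input (lab v) by case: (lab v).
case: (boolP (is_input _)) => inp; first by rewrite denE a6 andbF.
rewrite andbT [if ~~ false then _ else _]/= den_seq.
set s2 := den (PIf _ bigsum _) s1.
have s2E : s2 = if K < fan v then den bigsum s1 else den prsum s1.
  by rewrite /s2 den_if /= e15; case: (K < _).
have fr x : x \in [:: 11; 15; 23] -> regs s2 x = regs s1 x.
  by rewrite s2E !inE => /or3P[]/eqP ->; case: ifP => _; rewrite den_regs.
have fa a : arrays s2 a = arrays s1 a.
  by rewrite s2E; case: ifP => _; rewrite den_arrays.
have h : regs s2 13 = (if K < fan v then gsum C K gam v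
     else count (fun u => arrays s 6 u == 2) (pr v)) /\
  regs s2 14 = (if K < fan v then 0 else count (fun u => arrays s 6 u == 0) (pr v)).
  rewrite s2E; case: (ltnP K (fan v)) => [big|_] /=.
    exact: (bigsum_spec es1 gs1 vN f23 e15 big).
  by rewrite -a6; apply: (prsum_spec es1 vN e11 e15).
clearbody s2; clear s2E; case: h => h13 h14.
rewrite den_if.
have -> : expr_val s2 (Reg 14) = regs s2 14 by [].
rewrite h14.
have ge : expr_val s2 gate_expr = gate_val (lab v) (regs s2 13) (fan v).
  rewrite -e15 -fr //; apply: gate_expr_val => //.
    by rewrite fr // fa e11 (env_w es1) nth_code.
  by rewrite fr // fa e11 (env_w es1) nth_thr.
rewrite /newval h13 in ge *.
have ac x : arrays (set_cell s2 6 (expr_val s2 (Reg 23)) x) 6 u =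
    if u == v then x else arrays s 6 u.
  by rewrite /= fr // f23 fa a6.
have gE : expr_val s2 (Const 1 [+] gate_expr) = (expr_val s2 gate_expr).+1 by [].
case: ifP => big in ge *; first by rewrite den_write ac gE ge.
rewrite -lt0n -has_count; case: ifP => hs; first by rewrite den_write ac.
by rewrite den_write ac gE ge.
Qed.

Definition rounds := PFor 33 34 (Const d) (PFor 23 24 (Reg 2) gatev).

(** The vertices come in no particular order, but after pass [r] those of height at most [r] are
    final, and [d] passes reach all of them. *)
Lemma rounds_spec j gam tau s : env j s -> guessed gam s ->
  (forall v, v < N -> arrays s 6 v = rho C tau v) ->
  forall v, v < N -> arrays (den rounds s) 6 v = tval C K gam tau d v.
Proof.
move=> es gs hs.
pose T := tval C K gam tau d.
pose I0 st := env j st /\ guessed gam st.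
pose I r st := I0 st /\ forall v, v < N -> is_input (lab v) \/ hgt C r v -> arrays st 6 v = T v.
have TE v : ~~ is_input (lab v) -> T v = newval gam T v.
  by move=> /negbTE ni; rewrite /T (tvalE K depth_d) ni.
have hd : d <= cap0 by rewrite /cap0; lia.
have [_ h] : I d (den rounds s).
  apply: den_for => //.
  - exact: leq_trans hd (env_cap es).
  - split; first by split=> //; do 2![apply: env_set => //].
    move=> v vN h0; rewrite /= hs //.
    have iv : is_input (lab v) by case: h0 => // /hgt0.
    by rewrite /T (tvalE K depth_d) iv.
  move=> r st rd e33 [[est gst] hst]; split.
    split.
      by apply: env_set => //; apply: env_den.
    by move=> i iB; rewrite /= den_arrays // gst.
  (* Inside a pass, the vertices of height at most [r.+1] become final as they are visited, while
     those of height at most [r] are recomputed to the same value. *)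
  pose I2 v t := I0 t /\ forall u, u < N ->
    is_input (lab u) \/ hgt C r u \/ (hgt C r.+1 u /\ u < v) -> arrays t 6 u = T u.
  have [_ h2] : I2 N (den (PFor 23 24 (Reg 2) gatev) st).
    apply: den_for.
    - exact: env_N est.
    - by apply: leq_trans (env_cap est); have := N_cap; lia.
    - split; first by split=> //; do 2![apply: env_set => //].
      move=> u uN [hu|[hu|[_]]] //; apply: hst => //; [by left|by right].
    move=> v t vN e23 [[et gt] ht]; split.
      split; first by apply: env_set => //; apply: env_den.
      by move=> i iB; rewrite /= den_arrays // gt.
    move=> u uN hu; rewrite /= (gatev_spec et gt vN e23).
    case: eqP => [uv|/eqP uv] /=; last first.
      apply: ht => //; case: hu => [|[|[hu]]]; [by left|by right; left|].
      by rewrite ltnS leq_eqVlt (negbTE uv) /= => uv'; right; right.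
    rewrite {}uv in uN hu *; case: (boolP (is_input _)) => /= inp.
      by apply: ht => //; left.
    have hv : hgt C r.+1 v.
      case: hu => [iv|[hv|[]//]]; first by rewrite iv in inp.
      by move=> q u' uq lq; rewrite ltnW // ltnS (hv _ _ uq lq).
    rewrite TE // /newval; case: ifP => // _.
    have e u' : u' \in pr v -> arrays t 6 u' = T u'.
      move=> upr; have [uN' _] := mem_pr upr; apply: ht => //; right; left.
      exact: hgt_pr hv upr.
    have -> : has (fun u' => arrays t 6 u' == 0) (pr v) = has (fun u' => T u' == 0) (pr v).
      by apply: eq_in_has => u' /e ->.
    case: ifP => // _; congr (_ (gate_val _ _ _)).+1.
    by apply: eq_in_count => u' /e ->.
  move=> v vN hv /=; apply: h2 => //.
  by case: hv => hv; [left|right; right].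
by move=> v vN; apply: h => //; right; apply: hgt_d.
Qed.

Definition zero_body := PWrite 6 (Reg 23) (Const 0).

Definition rho_body :=
  let c := Read 5 (Reg 25) in
  PWrite 6 (Read 3 (c [/] Const 2)) (Const 2 [-] (c [-] ((c [/] Const 2) [*] Const 2))).

Definition setrho :=
  PFor 23 24 (Reg 2) zero_body;; PFor 25 26 (Reg 40) rho_body.

Definition clause_at (tau : seq nat) s := forall i, i < width -> arrays s 5 i = nth 0 tau i.

Lemma width_cap : width <= cap0. Proof. by rewrite /cap0; lia. Qed.

Lemma setrho_spec j tau s : env j s -> wft C K d tau -> clause_at tau s ->
  forall v, v < N -> arrays (den setrho s) 6 v = rho C tau v.
Proof.
move=> es /andP[/allP tn /eqP st] ts; rewrite /setrho !denE.
set s1 := den (PFor 23 24 _ _) s.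
have es1 : env j s1 by apply: env_den.
have a5 : arrays s1 5 = arrays s 5 by rewrite den_arrays.
have z : forall v, v < N -> arrays s1 6 v = 0.
  pose I k t := forall v, v < k -> arrays t 6 v = 0.
  rewrite -/(I N s1); apply: den_for => //; first exact: env_N es.
    by apply: leq_trans (env_cap es); have := N_cap; lia.
  move=> k t kN e23 h v; rewrite ltnS leq_eqVlt /zero_body !denE /= e23.
  by case: eqP => //= _; apply: h.
pose I i t := [/\ arrays t 5 = arrays s 5, arrays t 3 = arrays s1 3 &
  forall v, v < N -> arrays t 6 v = rho C (take i tau) v].
have [_ _ h] : I width (den (PFor 25 26 (Reg 40) rho_body) s1).
  apply: den_for; first exact: env_W es1.
  - exact: leq_trans width_cap (env_cap es1).
  - by split=> //= v vN; rewrite take0 z.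
  move=> i t iw e25 [f5 f3 h]; rewrite /rho_body !denE; split=> //= v vN.
  have it : i < size tau by rewrite st.
  have cn := tn _ (mem_nth 0 it).
  rewrite f3 f5 e25 ts // (take_nth 0 it) /rho -cats1 foldl_cat /= -/(rho C _ v) h //.
  rewrite modn_sub modn2 divn2 (env_ins es1) //.
  exact: half_lt.
by move=> v vN; rewrite h // -st take_size.
Qed.

Definition block_body :=
  PSet 20 ((Reg 11 [+] Const 3) [+] (Reg 29 [*] Const K));;
  PSet 21 (Reg 15 [-] (Reg 29 [*] Const K));;
  PIf (Const K [<] Reg 21) (PSet 21 (Const K)) PSkip;;
  cntp;;
  PIf (Reg 14) PSkip
    (PIf (Reg 13 [=] Read 4 (Read 2 (Reg 23) [+] Reg 29)) PSkip (PSet 16 (Const 1))).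

Lemma block_body_spec j gam s v b : env j s -> guessed gam s -> v < N ->
  b < nblocks v -> regs s 23 = v -> regs s 11 = off v -> regs s 15 = fan v ->
  regs s 29 = b ->
  regs (den block_body s) 16 = if badblock C K (arrays s 6) gam v b then 1 else regs s 16.
Proof.
move=> es gs vN bv e23 e11 e15 e29; rewrite /block_body 2!den_seq.
set s1 := den (PSet 21 _) _; rewrite den_seq.
set s2 := den (PIf _ (PSet 21 _) _) s1.
have sz : size (block C K v b) = if K < fan v - b * K then K else fan v - b * K.
  by rewrite /block size_take size_drop -/(fan v).
have e21 : regs s2 21 = size (block C K v b).
  rewrite /s2 den_if /s1 !denE /= e15 e29 sz; case: (ltnP K) => h //=.
have fr x : x \notin [:: 20; 21] -> regs s2 x = regs s x.
  rewrite !inE negb_or => /andP[x20 x21].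
  by rewrite !den_regs //= negb_or x21.
have fa : arrays s2 = arrays s by rewrite /s2 den_if; case: ifP.
have e20 : regs s2 20 = off v + 3 + b * K.
  by rewrite /s2 den_regs // /s1 !denE /= e11 e29.
have [|i ib|] := @cntp_spec s2 (block C K v b) e21.
- rewrite fr //; apply: leq_trans (env_cap es).
  by apply: leq_trans (@size_block C K v b) _; rewrite /cap0; lia.
- rewrite fa e20 (env_w es).
  have iK : i < K by apply: leq_trans ib (@size_block C K v b).
  have bi : b * K + i < fan v by move: ib; rewrite sz; case: (ltnP K); lia.
  by rewrite -addnA nth_pr // /block nth_take // nth_drop.
rewrite fa den_seq; set s3 := den cntp s2 => h13 h14.
have gr x : x \in [:: 16; 23; 29] -> regs s3 x = regs s x.
  by rewrite !inE => /or3P[] /eqP->; rewrite /s3 den_regs // fr.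
have ga : arrays s3 =2 arrays s by move=> a i; rewrite /s3 den_arrays // fa.
clearbody s3; rewrite den_if.
have -> : expr_val s3 (Reg 14) = regs s3 14 by [].
rewrite h14 -lt0n -has_count /badblock; case: ifP => _ /=; first by rewrite denE gr.
rewrite den_if.
have -> : expr_val s3 (Reg 13 [=] Read 4 (Read 2 (Reg 23) [+] Reg 29)) =
    (count (fun u => arrays s 6 u == 2) (block C K v b) == nth 0 gam (base v + b)).
  by rewrite /= h13 !ga !gr // e23 e29 (env_base es) // gs ?base_lt.
by case: (_ == nth 0 gam _); rewrite /= ?denE /= ?gr.
Qed.

Definition checkv :=
  PSet 11 (Read 1 (Reg 23));; PSet 15 (Read 0 (Reg 11 [+] Const 2));;
  PIf (Const K [<] Reg 15)
    (PFor 29 30 ((Reg 15 [/] Const K) [+] Const 1) block_body) PSkip.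

Lemma checkv_spec j gam s v : env j s -> guessed gam s -> v < N -> regs s 23 = v ->
  regs (den checkv s) 16 =
  if has (badblock C K (arrays s 6) gam v) (iota 0 (nblocks v)) then 1 else regs s 16.
Proof.
move=> es gs vN e23; rewrite /checkv 2!den_seq.
set s1 := den (PSet 15 _) _.
have s1E : s1 = set_reg (set_reg s 11 (off v)) 15 (fan v).
  rewrite /s1 !denE /=; congr (set_reg (set_reg _ _ _) _ _); rewrite ?e23 ?(env_off es) //.
  by rewrite (env_w es) nth_fan.
have es1 : env j s1 by rewrite s1E; do 2![apply: env_set => //].
rewrite den_if.
have -> : expr_val s1 (Const K [<] Reg 15) = (K < fan v) by rewrite s1E.
have e16 : regs s1 16 = regs s 16 by rewrite s1E.
case: (ltnP K (fan v)) => big /=; last by rewrite /nblocks ltnNge big.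
pose I b st := [/\ env j st, guessed gam st,
   [/\ regs st 23 = v, regs st 11 = off v & regs st 15 = fan v], arrays st 6 = arrays s 6 &
   regs st 16 = if has (badblock C K (arrays s 6) gam v) (iota 0 b) then 1 else regs s 16].
have bE : (fan v %/ K).+1 = nblocks v by rewrite /nblocks big.
have [] // : I (nblocks v) (den (PFor 29 30 ((Reg 15 [/] Const K) [+] Const 1) block_body) s1).
apply: den_for.
- by rewrite s1E -bE /= addn1.
- apply: leq_trans (env_cap es1); have := fan_cap vN; rewrite -bE.
  have := leq_div (fan v) K; lia.
- by rewrite s1E; split=> //; do 4![apply: env_set => //].
move=> b st bl e29 [est gst [f23 f11 f15] a6 h]; split.
- by apply: env_set => //; apply: env_den.
- by move=> i iB; rewrite /= den_arrays // gst.
- by split; rewrite /= den_regs.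
- by rewrite /= den_arrays.
rewrite [LHS]/= (block_body_spec est gst vN bl) // a6 h iota_rcons has_rcons add0n.
by case: has => /=; case: badblock.
Qed.

Definition check :=
  PSet 16 (Read 6 (Reg 3) [=] Const 1);; PFor 23 24 (Reg 2) checkv.

Lemma check_spec j gam tau s : env j s -> guessed gam s ->
  (forall v, v < N -> arrays s 6 v = tval C K gam tau d v) ->
  regs (den check s) 16 = viol C K d gam tau.
Proof.
move=> es gs h; rewrite /check !denE; set s1 := set_reg s 16 _.
have e16 : regs s1 16 = (tval C K gam tau d (output C) == 1).
  by rewrite /= (env_out es) h.
pose bad f v := has (badblock C K f gam v) (iota 0 (nblocks v)).
pose I v st := [/\ env j st, guessed gam st, arrays st 6 = arrays s 6 &
   regs st 16 = if has (bad (arrays s 6)) (iota 0 v) then 1 else regs s1 16].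
have [_ _ _ ->] : I N (den (PFor 23 24 (Reg 2) checkv) s1).
  apply: den_for; first exact: env_N es.
  - by apply: leq_trans (env_cap es); have := N_cap; lia.
  - by split=> //; do 3![apply: env_set => //].
  move=> v st vN e23 [est gst a6 hh]; split.
  - by apply: env_set => //; apply: env_den.
  - by move=> i iB; rewrite /= den_arrays // gst.
  - by rewrite /= den_arrays.
  rewrite [LHS]/= (checkv_spec est gst vN) // a6 hh iota_rcons has_rcons add0n.
  by rewrite -/(bad _ _); case: (bad _ _); case: has.
rewrite e16 /viol.
have -> : has (bad (arrays s 6)) (iota 0 N) = has (bad (tval C K gam tau d)) (iota 0 N).
  apply: eq_in_has => v; rewrite mem_iota add0n => vN; apply: eq_has => b.
  have e u : u \in block C K v b -> arrays s 6 u = tval C K gam tau d u.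
    by move/mem_block => ub; rewrite h //; case: (mem_pr ub).
  rewrite /badblock; congr (_ && _).
    by congr negb; apply: eq_in_has => u /e ->.
  by congr (_ != _); apply: eq_in_count => u /e ->.
by rewrite -/(bad _) orbC; case: has.
Qed.

(* The cells of the j-th guess in the input array of the SAT solver hold u. *)
Definition holds (j : nat) (A0 : nat -> nat) (u : seq nat) s :=
  forall x, arrays s 7 x = if x %% M == j then nth 0 u (x %/ M) else A0 x.

Lemma holds_set j A0 u s i v : j < M -> holds j A0 u s ->
  holds j A0 (set_nth 0 u i v) (set_cell s 7 (i * M + j) v).
Proof.
move=> jM h x /=; rewrite h nth_set_nth /=; case: (x =P i * M + j) => [->|ne].
  by rewrite modnMDl modn_small // eqxx divnMDl ?expn_gt0 // divn_small // addn0 eqxx.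
case: (x %% M =P j) => // xj; rewrite ifN //.
by apply/eqP=> xi; case: ne; rewrite -xi -xj -divn_eq.
Qed.

Definition emit_body :=
  PWrite 7 (addr (Reg 17)) (Read 5 (Reg 25));; PSet 17 (Reg 17 [+] Const 1).

Definition emit :=
  PIf (Reg 16)
    (PWrite 7 (addr (Reg 17)) (Reg 40);; PSet 17 (Reg 17 [+] Const 1);;
     PFor 25 26 (Reg 40) emit_body;; PSet 18 (Reg 18 [+] Const 1)) PSkip.

Lemma emit_spec j A0 u tau s : j < M -> env j s -> size tau = width ->
  clause_at tau s -> regs s 17 = size u -> holds j A0 u s ->
  let u' := if regs s 16 != 0 then u ++ width :: tau else u in
  [/\ regs (den emit s) 17 = size u', holds j A0 u' (den emit s) &
      regs (den emit s) 18 = regs s 18 + (regs s 16 != 0)].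
Proof.
move=> jM es st ts e17 hs; rewrite /emit den_if [expr_val _ _]/=.
case: ifP => _; last by rewrite denE addn0.
rewrite 2!den_seq; set s1 := den (PSet 17 _) _.
have es1 : env j s1 by do 2![apply: env_den => //].
have e17' : regs s1 17 = size (rcons u width).
  by rewrite /s1 !denE /= e17 size_rcons addn1.
have hs1 : holds j A0 (rcons u width) s1.
  have := holds_set (size u) (regs s 40) jM hs.
  rewrite {1}(env_W es) set_nth_size => h x.
  by rewrite /s1 !denE /= -h /= e17 (env_M es) (env_J es).
have ts1 : clause_at tau s1 by move=> i iw; rewrite /s1 !denE /= ts.
have e18 : regs s1 18 = regs s 18 by [].
clearbody s1.
pose I i t := [/\ env j t, clause_at tau t, regs t 18 = regs s 18,
   regs t 17 = size (rcons u width ++ take i tau) &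
   holds j A0 (rcons u width ++ take i tau) t].
have [] : I width (den (PFor 25 26 (Reg 40) emit_body) s1).
  apply: den_for; first exact: env_W es1.
  - exact: leq_trans width_cap (env_cap es1).
  - by rewrite /I take0 cats0; split=> //; do 2![apply: env_set => //].
  move=> i t iw e25 [et tt f18 f17 ht]; rewrite /emit_body !denE.
  have it : i < size tau by rewrite st.
  rewrite /I (take_nth 0 it) -rcons_cat size_rcons; split=> /=.
  - by do 2![apply: env_set => //]; apply: env_cell.
  - by move=> k kw /=; apply: tt.
  - by [].
  - by rewrite f17 addn1.
  move=> x; rewrite -set_nth_size -(holds_set _ _ jM ht) /=.
  by rewrite f17 e25 tt // (env_M et) (env_J et).
move=> et tt f18 f17 ht; rewrite den_seq den_set; split=> /=.
- by rewrite f17 -cats1 -catA -st take_size.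
- by move=> x /=; rewrite ht -cats1 -catA -st take_size.
- by rewrite f18.
Qed.

Definition gen_body := decode 31 5 40 5;; setrho;; rounds;; check;; emit.

(** Output starts at cell 2, because the number of clauses in the header is known only at the end.
    Array 8 is the solver's register 0, which must hold the length of its input word. *)
Definition gen :=
  decode 9 19 6 4;; PSet 17 (Const 2);; PSet 18 (Const 0);;
  PFor 31 32 (Reg 8) gen_body;;
  PWrite 7 (addr (Const 0)) (Reg 4);; PWrite 7 (addr (Const 1)) (Reg 18);;
  PWrite 8 (Reg 9) (Reg 17).

Lemma taus_take c : c < Q -> take c.+1 (taus C K d) =
  rcons (take c (taus C K d)) (digits (n + n) width c).
Proof.
move=> cQ; rewrite (take_nth [::]) ?size_map ?size_iota //.
by rewrite (nth_map 0) ?size_iota // nth_iota.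
Qed.

Lemma gen_loop j A0 s : j < M -> env j s -> guessed (guess C K j) s ->
  regs s 17 = 2 -> regs s 18 = 0 -> holds j A0 [:: 0; 0] s ->
  let s' := den (PFor 31 32 (Reg 8) gen_body) s in
  let taus' := [seq tau <- taus C K d | viol C K d (guess C K j) tau] in
  let u := [:: 0, 0 & flatten [seq width :: tau | tau <- taus']] in
  [/\ regs s' 17 = size u, regs s' 18 = size taus' & holds j A0 u s'].
Proof.
set gam := guess C K j.
move=> jM es gs e17 e18 hs.
pose tk c := [seq tau <- take c (taus C K d) | viol C K d gam tau].
pose u c := [:: 0, 0 & flatten [seq width :: tau | tau <- tk c]].
pose I c st := [/\ env j st, guessed gam st, regs st 17 = size (u c),
   regs st 18 = size (tk c) & holds j A0 (u c) st].
have szQ : size (taus C K d) = Q by rewrite size_map size_iota.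
have [] : I Q (den (PFor 31 32 (Reg 8) gen_body) s); last first.
  by rewrite /u /tk -szQ take_size.
apply: den_for.
- exact: env_Q es.
- exact: env_capQ es.
- by rewrite /I /u /tk take0; split=> //; do 2![apply: env_set => //].
move=> c st cQ e31 [est gst f17 f18 hst].
pose tau := digits (n + n) width c.
have wt : wft C K d tau.
  by rewrite -(mem_taus K d i0) // map_f // mem_iota.
rewrite /gen_body 4!den_seq.
set s1 := den (decode 31 5 40 5) st.
have es1 : env j s1 by apply: env_den.
have gs1 : guessed gam s1 by move=> i iB; rewrite /s1 den_arrays // gst.
have ts1 : clause_at tau s1.
  move=> i iw; rewrite /s1 decode_spec // (env_W est) //.
    by rewrite (env_n2 est) e31.
  exact: leq_trans width_cap (env_cap est).
have r1 := setrho_spec es1 wt ts1.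
set s2 := den setrho s1 in r1 *.
have es2 : env j s2 by apply: env_den.
have gs2 : guessed gam s2 by move=> i iB; rewrite /s2 den_arrays // gs1.
have r2 := rounds_spec es2 gs2 r1.
set s3 := den rounds s2 in r2 *.
have es3 : env j s3 by apply: env_den.
have gs3 : guessed gam s3 by move=> i iB; rewrite /s3 den_arrays // gs2.
have r3 := check_spec es3 gs3 r2.
set s4 := den check s3 in r3 *.
have es4 : env j s4 by apply: env_den.
have gs4 : guessed gam s4 by move=> i iB; rewrite /s4 den_arrays // gs3.
have ts4 : clause_at tau s4 by move=> i iB; rewrite /s4 den_arrays // /s3 den_arrays // /s2 den_arrays // ts1.
have fr x : x \in [:: 17; 18] -> regs s4 x = regs st x.
  by rewrite !inE => /orP[] /eqP->; rewrite /s4 /s3 /s2 /s1 !den_regs.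
have h7 : holds j A0 (u c) s4.
  by move=> x; rewrite /s4 /s3 /s2 /s1 !den_arrays // hst.
have sz : size tau = width by rewrite size_digits.
have [] := emit_spec jM es4 sz ts4 _ h7; first by rewrite fr.
rewrite r3 eqb0 negbK fr //; set v := viol _ _ _ _ _ => g17 g7 g18.
have tkS : tk c.+1 = if v then rcons (tk c) tau else tk c.
  by rewrite /tk taus_take // filter_rcons.
have uS : u c.+1 = if v then u c ++ width :: tau else u c.
  rewrite /u tkS; case: (v) => //.
  by rewrite map_rcons -cats1 flatten_cat /= cats0.
split.
- by apply: env_set => //; apply: env_den.
- by move=> i iB; rewrite /= den_arrays // gs4.
- by rewrite [LHS]/= uS.
- by rewrite [LHS]/= g18 f18 tkS; case: (v); rewrite ?size_rcons ?addn1 ?addn0.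
- by move=> x; rewrite uS; apply: g7.
Qed.

Lemma gen_spec j s : j < M -> env j s ->
  (forall a i, arr0 <= a -> i %% M = j -> arrays s a i = 0) ->
  let u := encode_cnf (cnf_of K d i0 (guess C K j)) in
  [/\ sim M j (init u) (den gen s), regs (den gen s) 17 = size u &
   forall a i, arr0 <= a -> i %% M != j -> arrays (den gen s) a i = arrays s a i].
Proof.
move=> jM es z; rewrite /gen den_seq.
set sd := den (decode _ _ _ _) s; rewrite !denE; set s0 := set_reg _ 18 _.
have esd : env j sd by apply: env_den.
have es0 : env j s0 by do 2![apply: env_set => //].
have gs0 : guessed (guess C K j) s0.
  move=> i iB; rewrite /= decode_spec // (env_B es) //.
    by rewrite (env_K es) (env_J es).
  exact: leq_trans base_cap (env_cap es).
have hs0 : holds j (arrays s 7) [:: 0; 0] s0.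
  move=> x; rewrite /= den_arrays //; case: eqP => // xj; rewrite z //.
  by case: (_ %/ _) => [|[|?]] //=; rewrite nth_nil.
have [] := gen_loop jM es0 gs0 _ _ hs0 => //.
set sL := den (PFor _ _ _ _) s0.
have esL : env j sL by apply: env_den.
have far a : 7 < a -> arrays sL a = arrays s a.
  by do 8![case: a => [//|a]] => _; rewrite /sL den_arrays //= den_arrays.
clearbody sL; set F := flatten _ => g17 g18 gh.
have h2 := holds_set 1 (regs sL 18) jM (holds_set 0 (regs sL 4) jM gh).
rewrite (env_n esL) g18 [set_nth _ _ 1 _]/= size_filter -(encode_cnf_of K d i0) in h2.
set wd := encode_cnf _ in h2 *.
have swd : size wd = regs sL 17 by rewrite g17 /wd encode_cnf_of.
clearbody wd.
set t := set_cell _ 8 _ _.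
have tE a i : arrays t a i = if (a == 8) && (i == j) then size wd else
    if a == 7 then (if i %% M == j then nth 0 wd (i %/ M) else arrays s 7 i)
    else arrays sL a i.
  rewrite /t /= (env_J esL) swd; case: (a =P 8) => [-> //|_] /=.
  case: (a =P 7) => [->|//]; rewrite -(h2 i) /= (env_M esL).
  by rewrite (env_n esL) g18 size_filter.
have jj : j %% M = j by rewrite modn_small.
have t7 : regs t 7 = M by exact: env_M esL.
have t9 : regs t 9 = j by exact: env_J esL.
have t17 : regs t 17 = size wd by rewrite swd.
clearbody t; split=> //; last first.
  move=> a i aa ij; rewrite tE; case: (i =P j) => [e|_]; first by rewrite e jj eqxx in ij.
  rewrite andbF (negbTE ij); case: (a =P 7) => [-> //|/eqP a7].
  by rewrite far // ltn_neqAle eq_sym a7.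
split=> //.
  move=> [|x] /=; rewrite tE //= ?eqxx //.
  rewrite far; last by lia.
  by rewrite z.
move=> [|a] i /=; rewrite tE /= ?modnMDl.
  by rewrite jj eqxx divnMDl ?expn_gt0 // divn_small // addn0.
by rewrite far ?z ?modnMDl //; lia.
Qed.

(** * Parsing the circuit *)

Definition parse_body :=
  PWrite 1 (Reg 23) (Reg 11);; PWrite 2 (Reg 23) (Reg 6);;
  PIf (Read 0 (Reg 11)) PSkip
    (PWrite 3 (Reg 4) (Reg 23);; PSet 4 (Reg 4 [+] Const 1));;
  PSet 15 (Read 0 (Reg 11 [+] Const 2));;
  PIf (Const K [<] Reg 15)
    (PSet 6 (Reg 6 [+] ((Reg 15 [/] Const K) [+] Const 1))) PSkip;;
  PSet 11 (Reg 11 [+] (Reg 15 [+] Const 3)).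

Definition parse :=
  PSet 2 (Read 0 (Const 0));; PSet 3 (Read 0 (Const 1));;
  PSet 4 (Const 0);; PSet 6 (Const 0);; PSet 11 (Const 2);;
  PFor 23 24 (Reg 2) parse_body;;
  PSet 5 (Reg 4 [+] Reg 4);; PSet 19 (Const K.+1);; PSet 40 (Const width);;
  pow 8 5 40;; pow 7 19 6.

Definition ins_below v := [seq u <- iota 0 v | is_input (lab u)].

Lemma ins_iota : ins = ins_below N.
Proof.
rewrite /ins /ins_below -val_enum_ord filter_map /enum_mem -filter_predI.
congr map; rewrite (eq_filter (a2 := mem (inputs C))).
  by [].
by move=> v; rewrite !inE /= /lab vertK andbT.
Qed.

Record parsed (v : nat) (s : state) : Prop := Parsed {
  ps_cap : regs s 1 = cap0;
  ps_N : regs s 2 = N;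
  ps_off : regs s 11 = off v;
  ps_base : regs s 6 = base v;
  ps_n : regs s 4 = size (ins_below v);
  ps_w : forall i, arrays s 0 i = nth 0 w i;
  ps_offs : forall u, u < v -> arrays s 1 u = off u;
  ps_bases : forall u, u < v -> arrays s 2 u = base u;
  ps_ins : forall i, i < size (ins_below v) -> arrays s 3 i = nth 0 (ins_below v) i
}.

Lemma parse_body_spec v s : v < N -> regs s 23 = v -> parsed v s ->
  parsed v.+1 (set_reg (den parse_body s) 23 v.+1).
Proof.
move=> vN e23 ps; case: (ps) => h1 h2 h11 h6 h4 hw ho hb hi.
have baseS : base v.+1 = base v + nblocks v by rewrite /base big_nat_recr.
have nbE : K < fan v -> nblocks v = (fan v %/ K).+1 by rewrite /nblocks => ->.
rewrite /parse_body 2!den_seq 2!den_write; set s1 := set_cell _ 2 _ _.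
have w1 : forall i, arrays s1 0 i = nth 0 w i by [].
have o1 : forall u, u < v.+1 -> arrays s1 1 u = off u.
  move=> u; rewrite ltnS leq_eqVlt /= e23 h11; case: eqP => [->//|_] /= uv.
  exact: ho.
have b1 : forall u, u < v.+1 -> arrays s1 2 u = base u.
  move=> u; rewrite ltnS leq_eqVlt /= e23 h6; case: eqP => [->//|_] /= uv.
  exact: hb.
have i1 : arrays s1 3 = arrays s 3 by [].
have r1 : regs s1 = regs s by [].
clearbody s1; rewrite den_seq; set s2 := den (PIf _ _ _) s1.
have s2E : s2 = if is_input (lab v)
    then set_reg (set_cell s1 3 (size (ins_below v)) v) 4 (size (ins_below v)).+1 else s1.
  rewrite /s2 den_if !denE /= r1 h11 w1 nth_code // h4 e23 addn1.
  by case: (lab v).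
have insS : ins_below v.+1 =
    if is_input (lab v) then rcons (ins_below v) v else ins_below v.
  by rewrite /ins_below iota_rcons filter_rcons.
have w2 : forall i, arrays s2 0 i = nth 0 w i by move=> i; rewrite s2E; case: ifP => _; apply: w1.
have o2 : forall u, u < v.+1 -> arrays s2 1 u = off u.
  by move=> u uv; rewrite s2E; case: ifP => _; rewrite -o1.
have b2 : forall u, u < v.+1 -> arrays s2 2 u = base u.
  by move=> u uv; rewrite s2E; case: ifP => _; rewrite -b1.
have i2 : forall i, i < size (ins_below v.+1) -> arrays s2 3 i = nth 0 (ins_below v.+1) i.
  move=> i; rewrite s2E insS; case: ifP => _; last by rewrite i1; apply: hi.
  rewrite size_rcons ltnS leq_eqVlt nth_rcons /= i1.
  case: eqP => [->|_] /= il; first by rewrite ltnn.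
  by rewrite il hi.
have r2 x : x != 4 -> regs s2 x = regs s x.
  by move=> /negbTE x4; rewrite s2E -r1; case: ifP => //= _; rewrite x4.
have n2 : regs s2 4 = size (ins_below v.+1).
  by rewrite s2E insS; case: ifP => _; rewrite ?size_rcons //= r1 h4.
clearbody s2; rewrite den_seq; set s3 := den (PSet 15 _) s2.
have s3E : s3 = set_reg s2 15 (fan v).
  by rewrite /s3 denE /= r2 // h11 w2 nth_fan.
clearbody s3.
rewrite den_seq; set s4 := den (PIf _ _ _) s3.
have s4E : s4 = if K < fan v then set_reg s3 6 (base v.+1) else s3.
  rewrite /s4 den_if.
  have -> : expr_val s3 (Const K [<] Reg 15) = (K < fan v) by rewrite s3E.
  case: ltnP => big; rewrite /= !denE //; congr set_reg.
  by rewrite s3E /= r2 // h6 baseS nbE // addn1.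
have r4 x : x != 6 -> x != 15 -> x != 4 -> regs s4 x = regs s x.
  move=> /negbTE x6 /negbTE x15 x4; rewrite s4E; case: ifP => _ /=.
    by rewrite x6 s3E /= x15 r2.
  by rewrite s3E /= x15 r2.
have a4 : arrays s4 = arrays s2 by rewrite s4E s3E; case: ifP.
have n4 : regs s4 4 = size (ins_below v.+1) by rewrite s4E s3E; case: ifP.
have f4 : regs s4 15 = fan v by rewrite s4E s3E; case: ifP.
have b4 : regs s4 6 = base v.+1.
  rewrite s4E s3E; case: ifP => //= big.
  by rewrite r2 // h6 baseS /nblocks big addn0.
clearbody s4; split; rewrite /= ?a4 ?f4 // ?r4 //.
by rewrite h11 /off big_nat_recr //= [fan v + 3]addnC -addnA.
Qed.

Lemma parse_spec s : regs s 1 = cap0 -> regs s 9 = 0 ->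
  (forall i, arrays s 0 i = nth 0 w i) ->
  regs (den parse s) 1 = cap0 /\ env 0 (set_reg (den parse s) 1 (cap0 + Q)).
Proof.
move=> h1 h9 hw; split; first by rewrite den_regs.
rewrite /parse 5!den_seq 5!den_set; set s0 := set_reg _ 11 _; rewrite den_seq.
set s1 := den (PFor _ _ _ _) s0.
have : parsed N s1.
  apply: (den_for (I := parsed)).
  - by rewrite /= hw.
  - by rewrite /= h1; have := N_cap; lia.
  - by split=> //=; rewrite ?hw // /off /base big_geq.
  by move=> v st vN e23; apply: parse_body_spec.
case=> g1 g2 g11 g6 g4 gw go gb gi.
have g9 : regs s1 9 = 0 by rewrite /s1 den_regs.
have g3 : regs s1 3 = output C by rewrite /s1 den_regs //= hw.
rewrite -ins_iota in g4 gi; rewrite size_ins in g4 gi.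
clearbody s1; rewrite 3!den_seq 3!den_set; set s2 := set_reg _ 40 _.
have k2 : regs s2 19 = K.+1 by [].
have n22 : regs s2 5 = n + n by rewrite /= g4.
have w2 : regs s2 40 = width by [].
rewrite den_seq; set s3 := den (pow 8 5 40) s2.
have q3 : regs s3 8 = Q.
  rewrite /s3 pow_spec // ?n22 ?w2 // [regs s2 1]/= g1; [exact: n2_cap|exact: width_cap].
have m4 : regs (den (pow 7 19 6) s3) 7 = M.
  by rewrite pow_spec // /s3 !den_regs // ?k2 /= ?g6 // g1 ?base_cap // /cap0; lia.
have fr x : x \notin [:: 7; 8; 27; 28; 37; 38; 39] ->
    regs (den (pow 7 19 6) s3) x = regs s2 x.
  rewrite !inE !negb_or => /and5P[x7 x8 x27 x28 /and3P[x37 x38 x39]].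
  by rewrite /s3 !den_regs //= !negb_or ?x7 ?x8 ?x27 ?x28 ?x37 ?x38 ?x39.
have fa : arrays (den (pow 7 19 6) s3) =2 arrays s1.
  by move=> a i; rewrite /s3 !den_arrays.
have q4 : regs (den (pow 7 19 6) s3) 8 = Q by rewrite den_regs.
move: fr fa m4 q4; set t := den _ s3 => fr fa m4 q4; clearbody t.
split=> /=; rewrite ?m4 ?q4 ?fr //=.
- exact: leq_addr.
- exact: leq_addl.
- by move=> i; rewrite fa.
- by move=> v vN; rewrite fa go.
- by move=> v vN; rewrite fa gb.
by move=> v vN; rewrite fa gi.
Qed.

End Program.

(** * Running time *)

Lemma exec_assign L x e s : bounded L s -> own e -> additive_expr e ->
  exists t, [/\ exec (Assign x e) s t (set_reg s x (expr_val s e)),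
    t <= esize e * esize e * L & bounded (L + esize e) (set_reg s x (expr_val s e))].
Proof.
move=> bs oe ae; exists (expr_cost s e); split; first exact: ExecAssign.
  exact: expr_cost_le.
by apply: (bounded_set bs); rewrite ?leq_addr ?bitlen_additive.
Qed.

(** Computing a value costs at least its bit length. This bounds the cost of reading the solver's
    answer, which may be any nonzero number. *)
Lemma bitlen_reg_exec p s t s' x : exec p s t s' ->
  bitlen (regs s' x) <= bitlen (regs s x) + t.
Proof.
elim=> {p s t s'} /=; try by move=> *; rewrite leq_addr.
- move=> s y e; case: eqP => _; last by rewrite leq_addr.
  by rewrite (leq_trans (expr_cost_gt s e)) // leq_addl.
- by move=> p1 p2 s1 s2 s3 t1 t2 _ h1 _ h2; lia.
- by move=> e p1 p2 s t s' _ h; lia.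
- by move=> e p s1 s2 s3 t1 t2 _ _ h1 _ h2; lia.
Qed.

Lemma env_frame (C : circuit) K d M j s s' : env C K d j s -> frame M j s s' -> env C K d j s'.
Proof.
move=> [h1 h2 h3 h4 h5 h6 h7 h8 h8' h9 h10 h11 h12 h13 h14 h15] [hr ha].
by split; rewrite ?hr // => *; rewrite ha //; auto.
Qed.

Lemma env_next (C : circuit) K d j s : env C K d j s -> env C K d j.+1 (set_reg s 9 j.+1).
Proof. by case. Qed.

Lemma bounded_frame M j L s s' : bounded L s -> frame M j s s' -> bounded L s'.
Proof.
by move=> [br ba] [hr ha]; split=> [x|a i aa]; rewrite ?hr // ha ?aa //; apply: ba.
Qed.

Section Run.
Variables (K d : nat) (p : cmd).

Definition init_cap := (Reg 0 [*] Const 2) [+] Const (K + width K d + d + 3).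

Definition loop :=
  Seq (compile (gen K d)) (Seq (hat p)
    (Seq (If (Read 8 (Reg Jreg)) (Assign 10 (Const 1)) Skip)
      (Assign Jreg (Reg Jreg [+] Const 1)))).

(** The loop over guesses is a bare [While]: its body contains the arbitrary program [hat p], and
    its number of rounds [M] is not bounded by the polynomial cap. *)
Definition main :=
  Seq (Assign capreg init_cap) (Seq (compile (parse K d))
    (Seq (Assign capreg (Reg capreg [+] Reg 8))
      (Seq (While (Reg Jreg [<] Reg Mreg) loop) (Assign 0 (Reg 10))))).

Lemma wf_gen : wf (gen K d). Proof. by []. Qed.
Lemma wf_parse : wf (parse K d). Proof. by []. Qed.

Section Circuit.
Variables (C : circuit) (Tm : nat).
Let n := #|inputs C|.
Variable i0 : 'I_n.
Hypotheses (K0 : 0 < K) (depth_d : depth C <= d).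
Local Notation M := (K.+1 ^ base C K (nverts C)).
Local Notation F j := (cnf_of K d i0 (guess C K j)).
Hypothesis solves : forall j, j < M ->
  exists2 t, answers p (encode_cnf (F j)) t (cnf_sat (F j)) & t <= Tm.

Definition fresh j s := forall a i, arr0 <= a -> j <= i %% M -> arrays s a i = 0.

Definition inv c L j s :=
  [/\ env C K d j s, bounded L s, fresh j s, regs s capreg <= c &
      regs s 10 = has (fun j => cnf_sat (F j)) (iota 0 j)].

(** Own memory grows by [W] bits in [gen] and by 3, the size of the increment, in the guess counter;
    by [frame] the solver's run adds nothing. *)
Lemma loop_step c L0 L j s : j < M -> bitlen M <= L0 -> inv c L j s ->
  let W := weight (gen K d) c in
  exists t s', [/\ exec loop s t s', inv c (L + W + 3) j.+1 s' &
    t <= (W + 30) * (L + W) + (15 * L0 + 1) * Tm].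
Proof.
move=> jM ML0 [es bs fs cs rs] W.
have [t1 [ex1 c1 b1]] := exec_compile wf_gen bs cs.
have [u zj|sim1 r17 fr1] := gen_spec i0 K0 depth_d jM es.
  by move=> ua uj; apply: fs => //; rewrite uj.
set s1 := den (gen K d) s in ex1 b1 sim1 r17 fr1 *.
have es1 : env C K d j s1 by apply: env_den.
have [tp [sf ex_p ans] tT] := solves jM.
have [t2 [s2 [ex2 sim2 c2 fr2]]] := hat_exec jM ML0 ex_p sim1.
have es2 := env_frame es1 fr2.
have b2 := bounded_frame b1 fr2.
have e9 : regs s2 9 = j by exact: env_J es2.
have r2 : arrays s2 8 j = regs sf 0 by case: sim2 => _ _ /(_ 0).
have rb : bitlen (regs sf 0) <= L + W + tp.
  apply: leq_trans (bitlen_reg_exec 0 ex_p) _; rewrite leq_add2r.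
  by rewrite [regs (init _) 0](esym r17); case: b1.
have jb : bitlen j <= L + W by rewrite -e9; case: b2.
pose s3 := if regs sf 0 != 0 then set_reg s2 10 1 else s2.
have [t3 ex3 c3] : exists2 t3,
    exec (If (Read 8 (Reg Jreg)) (Assign 10 (Const 1)) Skip) s2 t3 s3 &
    t3 <= 2 * (L + W) + tp + 1.
  exists (expr_cost s2 (Read 8 (Reg Jreg)) + 1).
    apply: ExecIf; rewrite /= e9 r2 /s3; case: ifP => _; last exact: ExecSkip.
    by have := ExecAssign s2 10 (Const 1); rewrite /= addn0 (bitlen_bool true).
  by rewrite /= e9 r2; lia.
have b3 : bounded (L + W) s3.
  rewrite /s3; case: ifP => _ //; apply: (bounded_set b2) => //.
  by rewrite (bitlen_bool true); apply: bounded_gt0 b2.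
have es3 : env C K d j s3 by rewrite /s3; case: ifP => _ //; apply: env_set.
have a3 : arrays s3 = arrays s2 by rewrite /s3; case: ifP.
have [t4 [ex4 c4 b4]] := exec_assign Jreg b3 (isT : own (Reg Jreg [+] Const 1)) isT.
have e4 : expr_val s3 (Reg Jreg [+] Const 1) = j.+1 by rewrite /= (env_J es3) addn1.
rewrite e4 /= (bitlen_bool true) in ex4 c4 b4.
exists (t1 + (t2 + (t3 + t4))), (set_reg s3 Jreg j.+1); split.
- exact: ExecSeq ex1 (ExecSeq ex2 (ExecSeq ex3 ex4)).
- split=> //.
  + exact: env_next es3.
  + move=> a i aa ij /=; rewrite a3.
    have ne : i %% M != j by rewrite gtn_eqF.
    by case: fr2 => _ ->; rewrite ?ne ?orbT // fr1 // fs // ltnW.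
  + have -> : regs (set_reg s3 Jreg j.+1) capreg = regs s capreg.
      rewrite /s3; case: ifP => _ /=; case: fr2 => h _; rewrite h /s1 den_regs //.
    by [].
  rewrite iota_rcons has_rcons add0n /s3 ans.
  have r10 : regs s2 10 = regs s 10 by case: fr2 => h _; rewrite h /s1 den_regs.
  by case: ifP => _ /=; rewrite ?r10 ?rs.
have L0' : 0 < L0 by apply: leq_trans ML0.
have h : 15 * L0 * tp <= 15 * L0 * Tm by rewrite leq_mul2l tT orbT.
rewrite -/W in c1; have L0'' := bounded_gt0 bs; clearbody W.
clear -c1 c2 c3 c4 h tT L0''.
rewrite [(W + 30) * _]mulnDl [(15 * L0 + 1) * Tm]mulnDl mul1n.
by move: (W * (L + W)) c1 => u3 c1; move: (15 * L0 * tp) (15 * L0 * Tm) h c2 => u1 u2 h c2; lia.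
Qed.

(** The bit bound is crude: it grows by [W + 3] in each of [M] rounds, which is why the total is of
    order [M * (M + Tm)] up to [overhead]. With [M] a small power of 2 to the [n], its square is
    affordable. *)
Lemma loop_total c L0 s : bitlen M <= L0 -> inv c L0 0 s ->
  let W := weight (gen K d) c in
  let LM := L0 + M * (W + 3) in
  exists t s', [/\ exec (While (Reg Jreg [<] Reg Mreg) loop) s t s', inv c LM M s' &
    t <= 9 * LM + M * (9 * LM + ((W + 30) * (LM + W) + (15 * L0 + 1) * Tm))].
Proof.
move=> ML0 inv0 W LM.
set D := 9 * LM + ((W + 30) * (LM + W) + (15 * L0 + 1) * Tm).
suff H : forall r j s1, j + r = M -> inv c (L0 + j * (W + 3)) j s1 ->
    exists t s', [/\ exec (While (Reg Jreg [<] Reg Mreg) loop) s1 t s', inv c LM M s' &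
      t <= 9 * LM + r * D].
  by apply: (H M 0); rewrite ?mul0n ?addn0.
have guard j s1 : j <= M -> inv c (L0 + j * (W + 3)) j s1 ->
    expr_val s1 (Reg Jreg [<] Reg Mreg) = (j < M) /\
    expr_cost s1 (Reg Jreg [<] Reg Mreg) <= 9 * LM.
  move=> jM [es bs _ _ _]; split; first by rewrite /= (env_J es) (env_M es).
  have b' : bounded LM s1.
    by apply: boundedW bs; rewrite /LM leq_add2l leq_mul2r jM orbT.
  exact: (expr_cost_le b' (isT : own (Reg Jreg [<] Reg Mreg))).
elim=> [|r IH] j s1 jr ij.
  have jM : j = M by rewrite -jr addn0.
  have [gv gc] := guard _ _ (eq_leq jM) ij.
  exists (expr_cost s1 (Reg Jreg [<] Reg Mreg)), s1; split.
  - by apply: ExecWhileStop; rewrite gv jM ltnn.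
  - by rewrite /LM -jM.
  - by rewrite (leq_trans gc) // leq_addr.
have jM : j < M by rewrite -jr addnS ltnS leq_addr.
have [gv gc] := guard _ _ (ltnW jM) ij.
have [t1 [s2 [ex1 ij1 c1]]] := loop_step jM ML0 ij.
have [|t2 [s3 [ex2 ij2 c2]]] := IH j.+1 s2 (etrans (addSnnS _ _) jr).
  move: ij1; rewrite -/W; clearbody W.
  by have -> : L0 + j * (W + 3) + W + 3 = L0 + j.+1 * (W + 3) by rewrite mulSn; lia.
exists (expr_cost s1 (Reg Jreg [<] Reg Mreg) + t1 + t2), s3; split=> //.
  by apply: ExecWhileStep ex1 ex2; rewrite gv jM.
have h : L0 + j * (W + 3) <= LM by rewrite /LM leq_add2l leq_mul2r (ltnW jM) orbT.
have h1 : (W + 30) * (L0 + j * (W + 3) + W) <= (W + 30) * (LM + W).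
  by rewrite leq_mul2l leq_add2r h orbT.
rewrite -/W in c1; clearbody W; rewrite [r.+1 * _]mulSn.
clear -c1 c2 h1 gc; rewrite -/D in c2 *.
have : D = 9 * LM + ((W + 30) * (LM + W) + (15 * L0 + 1) * Tm) by [].
move: c2; clearbody D; move: ((15 * L0 + 1) * Tm) c1 ((W + 30) * (LM + W)) h1 (r * D).
by move: ((W + 30) * _) => u1 u2 c1 u3 h1 u4; lia.
Qed.

End Circuit.

Definition parse_cap S := 2 * S + (K + width K d + d + 3).
Definition gen_cap S := parse_cap S + (2 * S) ^ width K d.
Definition parse_bits S := S.+1 + esize init_cap.
Definition parse_weight S := weight (parse K d) (parse_cap S).
Definition loop_bits S := parse_bits S + parse_weight S + 3.
Definition gen_weight S := weight (gen K d) (gen_cap S).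
(** The summands pay for setting the cap, parsing, raising the cap (an expression of size 3, hence
    9), the rounds of the loop, and finally the last guard with the assignment of the answer (9 and
    1). *)
Definition overhead S :=
  esize init_cap * esize init_cap * S.+1 + parse_weight S * (parse_bits S + parse_weight S) + 9 * (parse_bits S + parse_weight S) +
  ((gen_weight S + 39) * (loop_bits S + (gen_weight S + 3) + gen_weight S) + (15 * loop_bits S + 1)) +
  10 * (loop_bits S + (gen_weight S + 3)).

Lemma mem_bitsize w m : m \in w -> bitlen m <= bitsize w.
Proof. by move=> mw; rewrite /bitsize (big_rem _ mw) leq_addr. Qed.

Lemma size_bitsize w : size w <= bitsize w.
Proof. by rewrite /bitsize -sum1_size leq_sum. Qed.

Lemma bounded_init w : bounded (bitsize w).+1 (init w).
Proof.
have b0 : bitlen 0 = 1 := bitlen_bool false.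
split=> [x|a i _] /=.
  case: eqP => _; last by rewrite b0.
  by rewrite (leq_trans (bitlen_leq _)) // ltnS size_bitsize.
case: eqP => _; last by rewrite b0.
case: (ltnP i (size w)) => iw; last by rewrite nth_default // b0.
by rewrite ltnW // ltnS mem_bitsize // mem_nth.
Qed.

Lemma main_spec (C : circuit) (Tm : nat) (i0 : 'I_#|inputs C|) :
  0 < K -> depth C <= d ->
  let M := K.+1 ^ base C K (nverts C) in
  let F j := cnf_of K d i0 (guess C K j) in
  (forall j, j < M -> exists2 t, answers p (encode_cnf (F j)) t (cnf_sat (F j)) & t <= Tm) ->
  exists2 t, answers main (encode_circuit C) t (circuit_sat C) &
    t <= overhead (bitsize (encode_circuit C)) * (M * (M + Tm)).
Proof.
move=> K0 depth_d M F solves; set w := encode_circuit C; set S := bitsize w.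
have wS : size w <= S := size_bitsize w.
have b0 := bounded_init w; rewrite -/S in b0.
have [t1 [ex1 k1 b1]] := exec_assign capreg b0 (isT : own init_cap) isT.
rewrite [expr_val _ _](_ : _ = cap0 C K d) in ex1 b1; last by rewrite /= mulnC.
set s1 := set_reg _ _ _ in ex1 b1.
have cap1 : regs s1 capreg <= parse_cap S by rewrite /= /cap0 /parse_cap leq_add2r leq_mul2l wS orbT.
have [t2 [ex2 k2 b2]] := exec_compile wf_parse b1 cap1.
have [|||p1 p2] := parse_spec K0 depth_d (s := s1) => //.
have a2 a i : arr0 <= a -> arrays (den (parse K d) s1) a i = 0.
  by do 7![case: a => [//|a]] => _; rewrite den_arrays.
have r2 : regs (den (parse K d) s1) 10 = 0 by rewrite den_regs.
set s2 := den _ s1 in ex2 b2 p1 p2 a2 r2.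
have [t3 [ex3 k3 b3]] :=
  exec_assign capreg b2 (isT : own (Reg capreg [+] Reg 8)) isT.
have q2 : regs s2 8 = (#|inputs C| + #|inputs C|) ^ width K d := env_Q p2.
rewrite [expr_val _ _](_ : _ = cap0 C K d + (#|inputs C| + #|inputs C|) ^ width K d) in ex3 b3;
  last by rewrite /= p1 q2.
set s3 := set_reg s2 _ _ in ex3 b3 p2.
have cap3 : regs s3 capreg <= gen_cap S.
  rewrite /gen_cap; apply: leq_add; first exact: cap1.
  rewrite leq_exp2r ?expn_gt0 ?K0 // addnn -mul2n leq_mul2l.
  by rewrite (leq_trans _ wS) // ltnW // ins_size.
have ML : bitlen M <= loop_bits S.
  by rewrite /M -(env_M p2); case: b3.
have inv0 : inv i0 (gen_cap S) (loop_bits S) 0 s3.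
  by split=> // a i aa _; apply: a2.
have [t4 [s4 [ex4 [es4 bs4 _ _ r4] k4]]] := loop_total K0 depth_d solves ML inv0.
have [t5 [ex5 k5 _]] := exec_assign 0 bs4 (isT : own (Reg 10)) isT.
exists (t1 + (t2 + (t3 + (t4 + t5)))).
  eexists; first exact: ExecSeq ex1 (ExecSeq ex2 (ExecSeq ex3 (ExecSeq ex4 ex5))).
  by rewrite (circuit_satE i0 K0 depth_d) /= r4 eqb0 negbK.
have M0 : 0 < M by rewrite expn_gt0.
set P := M * (M + Tm); have P0 : 0 < P by rewrite muln_gt0 M0 addn_gt0 M0.
have MP : M <= P by rewrite leq_pmulr // addn_gt0 M0.
set B := loop_bits S + (gen_weight S + 3).
move: k4 k5; rewrite -/(gen_weight S); set LM := loop_bits S + M * (gen_weight S + 3) => k4 k5.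
have LMB : LM <= M * B by rewrite /B mulnDr leq_add2r leq_pmull.
have h1 : 10 * LM <= 10 * B * P.
  by rewrite -mulnA leq_mul2l (leq_trans LMB) // mulnC leq_mul2l MP orbT.
have h2 : 9 * LM + ((gen_weight S + 30) * (LM + gen_weight S) + (15 * loop_bits S + 1) * Tm) <=
    ((gen_weight S + 39) * (B + gen_weight S) + (15 * loop_bits S + 1)) * (M + Tm).
  have LMW : LM + gen_weight S <= (B + gen_weight S) * M.
    by rewrite mulnDl leq_add //; [rewrite mulnC|rewrite leq_pmulr].
  apply: (@leq_trans ((gen_weight S + 39) * ((B + gen_weight S) * M) + (15 * loop_bits S + 1) * Tm)).
    rewrite addnA leq_add2r addnC (_ : 39 = 30 + 9) // addnA [X in _ <= X]mulnDl.
    rewrite leq_add // leq_mul2l ?LMW ?orbT //.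
    by rewrite (leq_trans _ LMW) // leq_addr.
  rewrite [X in _ <= X]mulnDl leq_add //; last by rewrite leq_mul2l leq_addl orbT.
  by rewrite mulnA leq_mul2l leq_addr orbT.
have h3 := leq_mul (leqnn M) h2; rewrite mulnCA -/P in h3.
have k45 := leq_add k4 k5; rewrite -[esize (Reg 10) * _ * LM]/(LM + 0) in k45.
rewrite /overhead -/B 4!mulnDl; set x1 := _ * P; set x2 := _ * P; set x3 := _ * P.
have g1 : t1 <= x1 by rewrite (leq_trans k1) // leq_pmulr.
have g2 : t2 <= x2 by rewrite (leq_trans k2) // leq_pmulr.
have g3 : t3 <= x3 by rewrite (leq_trans k3) // leq_pmulr.
move: k45 h3 h1; clear -g1 g2 g3.
set u1 := M * _; set u2 := _ * P; set u3 := 10 * B * P.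
clearbody u1 u2 u3 x1 x2 x3; lia.
Qed.

Lemma polyb_overhead : polyb overhead.
Proof.
have pc1 : polyb parse_cap.
  by apply: polybD; [apply: polybM; [exact: polyb_const|exact: polyb_id]|exact: polyb_const].
have pexp k : polyb (fun S => (2 * S) ^ k).
  elim: k => [|k IH]; first by exists 1, 0 => S; rewrite !expn0.
  have [A [D h]] : polyb (fun S => 2 * S * (2 * S) ^ k).
    by apply: polybM => //; apply: polybM; [exact: polyb_const|exact: polyb_id].
  by exists A, D => S; rewrite expnS.
have pS : polyb succn by exists 1, 1 => S; rewrite mul1n expn1.
have pc2 : polyb gen_cap by apply: polybD.
have pL1 : polyb parse_bits by apply: polybD => //; apply: polyb_const.
have pW1 : polyb parse_weight := polyb_comp (polyb_weight _) pc1.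
have pW2 : polyb gen_weight := polyb_comp (polyb_weight _) pc2.
have pL13 : polyb (fun S => parse_bits S + parse_weight S) by apply: polybD.
have pL3 : polyb loop_bits by apply: polybD => //; apply: polyb_const.
have pc := polyb_const.
have pG := polybD pL3 (polybD pW2 (pc 3)).
apply: (polybD (polybD (polybD (polybD (polybM (pc _) pS) (polybM pW1 pL13))
  (polybM (pc 9) pL13)) (polybD (polybM (polybD pW2 (pc 39)) (polybD pG pW2))
  (polybD (polybM (pc 15) pL3) (pc 1)))) (polybM (pc 10) pG)).
Qed.

End Run.

(** * Choice of the constants and the final exponent *)

Lemma inputs_gt0 (C : circuit) : 0 < #|inputs C|.
Proof.
(* The start of a longest path is an input, since a wire into it would prolong the path. *)
have [u [p [up sp]]] := depth_path C.
apply/card_gt0P; exists u; rewrite inE circuit_input cards_eq0; apply/eqP/setP=> v.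
rewrite !inE; apply/negP=> vu; have := @path_size_depth C v (u :: p).
by rewrite /= vu up sp ltnn => /(_ isT).
Qed.

Lemma sqr_le_exp2 a : 4 <= a -> a * a <= 2 ^ a.
Proof.
elim: a => // a IH; rewrite leq_eqVlt => /orP[/eqP <- //|]; rewrite ltnS => a4.
by have := IH a4; rewrite expnS; nia.
Qed.

Local Open Scope ring_scope.

(** With [K = 2 ^ a - 1] a guess for [B] blocks takes exactly [a * B] bits, so no logarithm appears.
    As [K * B <= 2 * c * n], the inequality asked for here gives [a * B <= e * n]. *)
Lemma digit_choice (R : realType) (c e : R) : 0 < e ->
  exists2 a : nat, (0 < a)%N & 2 * c * a%:R <= e * (2 ^ a).-1%:R.
Proof.
move=> e0; pose x := 2 * `|c| / e; pose b := Num.bound x.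
have xb : x <= b%:R by apply/ltW/archi_boundP; rewrite /x !mulr_ge0 ?invr_ge0 // ltW.
(* Adding 4 makes [sqr_le_exp2] applicable, and [(b + 4) * b] stays below the square by more than
   the 1 lost in [K]. *)
exists (b + 4)%N; first by rewrite addn_gt0 orbT.
have h1 : (b + 4)%:R * x <= (2 ^ (b + 4)).-1%:R.
  apply: (@le_trans _ _ ((b + 4)%:R * b%:R)); first by rewrite ler_wpM2l.
  rewrite -natrM ler_nat; have := @sqr_le_exp2 (b + 4)%N (leq_addl _ _).
  by move: (2 ^ (b + 4))%N => u; nia.
apply: (@le_trans _ _ (e * ((b + 4)%:R * x))); last by rewrite ler_wpM2l // ltW.
have -> : e * ((b + 4)%:R * x) = 2 * `|c| * (b + 4)%:R.
  by rewrite /x; field; rewrite gt_eqF.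
by rewrite ler_wpM2r // ler_wpM2l // ler_norm.
Qed.

(** Since [s_] is nondecreasing, every [s_ R k] is at most its limit, so one [delta] above the limit
    serves all [k]. *)
Lemma sat_solvers (R : realType) : (s_infty R < 1%:E)%E ->
  exists2 delta : R, 0 < delta < 1 &
  forall k, exists (p : cmd) (Kp : R), 0 <= Kp /\ forall (n : nat) (F : cnf n), dcnf k F ->
    exists2 t : nat, answers p (encode_cnf F) t (cnf_sat F) &
      t%:R <= Kp * 2 `^ (delta * n%:R).
Proof.
move=> s1.
(* An extended real below 1 may also be [-oo] or at most 0 as far as is known here; [1/2] covers
   these cases. *)
have [delta d01 sd] : exists2 delta : R, 0 < delta < 1 & (s_infty R < delta%:E)%E.
  case: (s_infty R) s1 => [r|//|_].
    rewrite lte_fin => r1; have [r0|r0] := leP r 0.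
      by exists (1/2); [lra|rewrite lte_fin; lra].
    by exists ((r + 1) / 2); [lra|rewrite lte_fin; lra].
  by exists (1/2); [lra|rewrite ltNyr].
exists delta => // k.
have le_s : (s_ R k <= s_infty R)%E.
  rewrite /s_infty (cvg_lim _ (ereal_nondecreasing_cvgn (@s_nondecreasing R))) //.
  by apply: ereal_sup_ubound; exists k.
have [_ [dl [dl0 [p [K pK]]] <-]] := ereal_inf_lt (le_lt_trans le_s sd).
rewrite lte_fin => dd; exists p, `|K|; split=> // n F dF.
have [t ans tb] := pK n F dF; exists t => //; apply: le_trans tb _.
apply: (@le_trans _ _ (`|K| * 2 `^ (dl * n%:R))).
  by rewrite ler_wpM2r ?powR_ge0 // ler_norm.
rewrite ler_wpM2l // ler_powR ?ler1n // ler_wpM2r //.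
exact: ltW.
Qed.

Lemma powR2_lt2 (R : realType) (r : R) : r < 1 -> 2 `^ r < 2 :> R.
Proof.
move=> r1; have h : (1 : R) < 2 `^ (1 - r).
  rewrite lt_neqAle eq_sym powR_eq1; apply/andP; split.
    by apply/negP=> /or3P[/eqP||/eqP]; lra.
  by rewrite -[X in X <= _](powRr0 (2 : R)) ler_powR ?ler1n // subr_ge0 ltW.
have : 2 `^ r * 1 < 2 `^ r * 2 `^ (1 - r) :> R by rewrite ltr_pM2l ?powR_gt0.
by rewrite mulr1 -powRD ?pnatr_eq0 ?implybT // addrC subrK powRr1.
Qed.

Lemma guesses_le (R : realType) (c e : R) (C : circuit) (a : nat) :
  (0 < a)%N -> 2 * c * a%:R <= e * (2 ^ a).-1%:R -> (wires C)%:R <= c * #|inputs C|%:R ->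
  (((2 ^ a).-1.+1 ^ base C (2 ^ a).-1 (nverts C))%N)%:R <= 2 `^ (e * #|inputs C|%:R) :> R.
Proof.
move=> a0 ea wc; set K := (2 ^ a).-1; set B := base _ _ _; set n := #|inputs C|.
have Ka : K.+1 = (2 ^ a)%N by rewrite prednK // expn_gt0.
have K0 : (0 < K)%N by rewrite -ltnS Ka -{1}(expn0 2) ltn_exp2l.
rewrite Ka -expnM natrX -powR_mulrn // ler_powR ?ler1n //.
rewrite -(@ler_pM2r _ K%:R) ?ltr0n //.
have BW : (K * B <= 2 * wires C)%N by apply: base_wires.
have h1 : (a * B)%:R * K%:R <= a%:R * (2 * (wires C)%:R) :> R.
  by rewrite -!natrM ler_nat -mulnA leq_mul2l mulnC BW orbT.
apply: (le_trans h1); apply: (@le_trans _ _ (a%:R * (2 * (c * n%:R)))).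
  by rewrite ler_wpM2l // ler_wpM2l.
have -> : a%:R * (2 * (c * n%:R)) = 2 * c * a%:R * n%:R by ring.
by rewrite [e * _ * _]mulrAC ler_wpM2r.
Qed.

Theorem theorem1p5 (R : realType) (SETH_fails : (s_infty R < 1%:E)%E) :
  exists2 eps : R, 0 < eps &
    forall (c : R) (d : nat),
    exists (p : cmd) (q : {poly R}),
    forall (n : nat) (C : circuit),
      #|inputs C| = n -> (wires C)%:R <= c * n%:R -> (depth C <= d)%N ->
      exists2 t : nat,
        answers p (encode_circuit C) t (circuit_sat C)
      & t%:R <= q.[(bitsize (encode_circuit C))%:R] * (2 - eps) ^+ n.
Proof.
have [delta /andP[d0 d1] solver] := sat_solvers SETH_fails.
(* [lam] is the midpoint of [delta] and 1. The factors [M * M] and [M * Tm] in the running time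
   require [2 * e <= lam] and [e + delta <= lam], and a quarter of the gap achieves both. With the
   [eps] chosen next, [2 - eps] is 2 to the power [lam]. *)
pose lam := (1 + delta) / 2; pose e := (1 - delta) / 4.
have e0 : 0 < e by rewrite /e; lra.
exists (2 - 2 `^ lam).
  by rewrite subr_gt0 powR2_lt2 // /lam; lra.
move=> c d; have [a a0 ea] := digit_choice c e0.
pose K := (2 ^ a).-1.
have Ka : K.+1 = (2 ^ a)%N by rewrite prednK // expn_gt0.
have K0 : (0 < K)%N by rewrite -ltnS Ka -{1}(expn0 2) ltn_exp2l.
have [p [Kp [Kp0 solves]]] := solver (width K d).
have [A [D ov]] := polyb_overhead K d.
exists (main K d p), ((A%:R * (1 + Kp)) *: ('X + 2%:P) ^+ D) => n C nE wc dC.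
rewrite -nE in wc *; set S := bitsize _.
have i0 : 'I_#|inputs C| := Ordinal (inputs_gt0 C).
pose x : R := 2 `^ (e * #|inputs C|%:R); pose y : R := 2 `^ (delta * #|inputs C|%:R).
have y0 : 0 <= Kp * y by rewrite mulr_ge0 ?powR_ge0.
(* Running times are naturals, so rounding the real bound down loses nothing. *)
pose Tm := Num.truncn (Kp * y).
set M := (K.+1 ^ base C K (nverts C))%N.
have [j jM|t ans tb] := @main_spec K d p C Tm i0 K0 dC.
  have [t ans tb] := solves _ _ (dcnf_cnf_of K d i0 (guess C K j)).
  by exists t => //; rewrite /Tm truncn_ge_nat.
exists t => //.
have Mx : M%:R <= x by apply: guesses_le a0 ea wc.
have Ty : Tm%:R <= Kp * y by rewrite truncn_le.
pose z : R := 2 `^ (lam * #|inputs C|%:R).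
have pw r s : 2 `^ r * 2 `^ s = 2 `^ (r + s) :> R by rewrite powRD // pnatr_eq0 implybT.
have xx : x * x <= z.
  rewrite pw -mulrDl ler_powR ?ler1n // ler_wpM2r // /e /lam; lra.
have xy : x * y <= z.
  rewrite pw -mulrDl ler_powR ?ler1n // ler_wpM2r // /e /lam; lra.
have -> : (2 - (2 - 2 `^ lam)) ^+ #|inputs C| = z.
  by rewrite opprB addrC subrK /z powRrM powR_mulrn ?powR_ge0.
have bnd : t%:R <= A%:R * (S%:R + 2) ^+ D * (x * (x + Kp * y)).
  apply: (@le_trans _ _ ((A * S.+2 ^ D)%N * (M * (M + Tm)))%N%:R).
    by rewrite ler_nat (leq_trans tb) // leq_mul2r ov orbT.
  rewrite !natrM natrX natrD -addn2 natrD.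
  have M0 : 0 <= M%:R :> R by [].
  rewrite ler_wpM2l ?mulr_ge0 ?exprn_ge0 ?addr_ge0 //.
  by rewrite ler_pM ?addr_ge0 // lerD.
apply: (le_trans bnd).
rewrite hornerZ horner_exp hornerD hornerX hornerC.
have -> : A%:R * (1 + Kp) * (S%:R + 2) ^+ D * z = A%:R * (S%:R + 2) ^+ D * ((1 + Kp) * z).
  by ring.
rewrite ler_wpM2l ?mulr_ge0 ?exprn_ge0 ?addr_ge0 //.
by rewrite mulrDr mulrDl mul1r mulrCA lerD // ler_wpM2l.
Qed.
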